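(* Let $\mathcal H$ be a real Hilbert space, let $L>0$, $D>0$, $\sigma\ge 0$, $L_\Delta\ge 0$, and set $\overline L:=\sqrt{L^2+L_\Delta^2}$. Let $F:\mathcal H\to\mathcal H$ be monotone and $L$-Lipschitz, let $A:\mathcal H\rightrightarrows\mathcal H$ be maximally monotone, let $z_0\in\mathcal H$, and suppose there is $z_\star\in\mathcal H$ with $0\in F(z_\star)+A(z_\star)$ and $\|z_0-z_\star\|\le D$. Let $F_\xi(z)=F(z)+\delta_\xi(z)$ be a stochastic oracle such that, for all $x,y,z\in\mathcal H$, $$\mathbb E[\delta_\xi(z)]=0,\qquad \mathbb E\|\delta_\xi(z)\|^2\le\sigma^2,\qquad \mathbb E\|\delta_\xi(x)-\delta_\xi(y)\|^2\le L_\Delta^2\|x-y\|^2,$$ and such that each sampled operator $F_\xi$ may be evaluated at several points. Let $\xi_0,\xi_1,\dots$ be independent samples. Define, for $k\ge 0$, $$\alpha_0=\frac{7}{12\overline L},\qquad \alpha_{k+1}=\frac{2(k+3)}{2k+7}\alpha_k,\qquad \beta_k=\frac{3}{k+3},\qquad \gamma_{k+1}=\frac{4k+13}{4(k+3)(k+4)},$$ and let $v_0=F_{\xi_0}(z_0)$ and, for $k\ge0$ (VRAF), $$z_{k+1}=J_{\alpha_kA}\bigl((1-\beta_k)z_k+\beta_kz_0-\alpha_kv_k\bigr),\qquad v_{k+1}=F_{\xi_{k+1}}(z_{k+1})+(1-\gamma_{k+1})\bigl(v_k-F_{\xi_{k+1}}(z_k)\bigr).$$ Then, for every integer $N\ge1$,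 $$\mathbb E[\mathcal R(z_N)^2]\le 35\,\frac{\overline L^2D^2+\sigma^2}{N+2}.$$
   Context: $J_{\alpha A}:=(I+\alpha A)^{-1}$ is the resolvent of $A$ for $\alpha>0$, assumed exactly available. The residual is $\mathcal R(z):=\operatorname{dist}(0,F(z)+A(z))$. Monotone means $\langle F(x)-F(y),x-y\rangle\ge0$ for all $x,y$. In the expectations of the oracle conditions the points $x,y,z$ are fixed and the expectation is over the sample $\xi$; fresh samples are independent and identically distributed. In the VRAF update the same sample $\xi_{k+1}$ is used at $z_{k+1}$ and $z_k$. *)

(* Defs.v *)
From HB Require Import structures.
From mathcomp Require Import all_boot all_order all_algebra finmap.
From mathcomp Require Import all_classical all_reals all_analysis.

Set Implicit Arguments.
Unset Strict Implicit.
Unset Printing Implicit Defensive.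

Import Order.TTheory GRing.Theory Num.Theory.
Import numFieldNormedType.Exports.

Local Open Scope classical_set_scope.
Local Open Scope ring_scope.

(* [H] equipped with its Borel sigma-algebra. *)
Notation borel H := (g_sigma_algebraType (@open H)).

Section hilbert.
Context {R : realType} {H : completeNormedModType R}.
Variable dot : {dot H for idfun}.

(* The norm of [H] is the one induced by the inner product; as [H] is complete,
   [H] is then a real Hilbert space, with no separability assumption. *)
Definition hilbert_norm := forall x : H, dot x x = `|x| ^+ 2.

Definition monotone_fun (F : H -> H) :=
  forall x y, 0 <= dot (F x - F y) (x - y).

(* A set-valued operator is a map [A : H -> set H]; [A x] may be empty. *)
Definition monotone_op (A : H -> set H) :=
  forall x y u v, A x u -> A y v -> 0 <= dot (u - v) (x - y).

Definition maximally_monotone (A : H -> set H) :=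
  monotone_op A /\
  forall B : H -> set H, monotone_op B ->
    (forall x, A x `<=` B x) -> forall x, B x `<=` A x.

End hilbert.

Section operators.
Context {R : realType} {H : completeNormedModType R}.

(* The relational inverse of [I + alpha A]: [resolvent alpha A x] is the set of
   all [y] with [x \in y + alpha A(y)]. For [A] maximally monotone and
   [alpha > 0] it has exactly one element. *)
Definition resolvent (alpha : R) (A : H -> set H) (x : H) : set H :=
  [set y | exists2 u, A y u & y + alpha *: u = x].

(* Equal to [+oo] when [A z] is empty. *)
Definition residual (F : H -> H) (A : H -> set H) (z : H) : \bar R :=
  edist_inf [set F z + u | u in A z] 0.

Definition sampled_operator {S : Type} (F : H -> H) (delta : S -> H -> H)
    (s : S) (z : H) : H :=
  F z + delta s z.

End operators.

Section probability.
Context {R : realType}.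

(* [m] is the Bochner integral of [X]: [X] is the L^1-limit of a sequence of
   finitely-valued measurable functions whose elementary integrals tend to [m].
   In particular [X] is essentially separably valued. *)
Definition is_bochner_integral {d} {S : measurableType d}
    {H : completeNormedModType R} (mu : probability S R) (X : S -> H) (m : H) :=
  measurable_fun setT (X : S -> borel H) /\
  exists f : nat -> S -> H,
    [/\ forall n, finite_set (range (f n)),
        forall n y, measurable (f n @^-1` [set y]),
        (\int[mu]_s (`|X s - f n s|)%:E)%E @[n --> \oo] --> 0%E
      & \sum_(y \in range (f n)) fine (mu (f n @^-1` [set y])) *: y
          @[n --> \oo] --> m].

Definition mutually_independent {d d'} {Omega : measurableType d}
    {S : measurableType d'} (P : probability Omega R)
    (xi : nat -> {mfun Omega >-> S}) :=
  forall (J : {fset nat}) (B : nat -> set S),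
    (forall i, i \in J -> measurable (B i)) ->
    P (\bigcap_(i in [set` J]) (xi i @^-1` B i)) =
    (\prod_(i <- J) P (xi i @^-1` B i))%E.

End probability.

Section vraf.
Context {R : realType}.

Fixpoint alpha (Lbar : R) (k : nat) : R :=
  if k is j.+1 then 2 * (j%:R + 3) / (2 * j%:R + 7) * alpha Lbar j
  else 7 / (12 * Lbar).

Definition beta (k : nat) : R := 3 / (k%:R + 3).

(* [gamma_next k] is the parameter gamma_(k+1), used in the update of [v k.+1]. *)
Definition gamma_next (k : nat) : R :=
  (4 * k%:R + 13) / (4 * (k%:R + 3) * (k%:R + 4)).

(* [z] and [v] are the VRAF iterates; the sample [xi k.+1] is evaluated both at
   [z k.+1] and at [z k]. *)
Definition is_vraf {H : completeNormedModType R} {Omega S : Type} (Lbar : R)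
    (F : H -> H) (A : H -> set H) (z0 : H) (delta : S -> H -> H)
    (xi : nat -> Omega -> S) (z v : nat -> Omega -> H) :=
  forall w : Omega,
    [/\ z 0 w = z0,
        v 0 w = sampled_operator F delta (xi 0 w) z0,
        forall k, resolvent (alpha Lbar k) A
          ((1 - beta k) *: z k w + beta k *: z0 - alpha Lbar k *: v k w)
          (z k.+1 w)
      & forall k, v k.+1 w =
          sampled_operator F delta (xi k.+1 w) (z k.+1 w) +
          (1 - gamma_next k) *:
            (v k w - sampled_operator F delta (xi k.+1 w) (z k w))].

End vraf.

(* Main.v *)
(* Write d_k = z_(k+1) - z_k, p_k = z_0 - z_k, u = z_0 - z_* and
   e_k = alpha_k (v_k - F z_k).  Monotonicity of A between consecutive
   resolvent steps bounds |d_k|^2 by the inner product of d_k with an explicit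
   combination of d_(k-1), F z_k - F z_(k-1), e_(k-1), p_k and the fresh noise,
   and e_k = (k + 3/2) / (k + 3) e_(k-1) + (noise centred given the past).
   For constants w_k, c_k the potential
     V_k = w_k |d_(k-1)|^2 + (k + 2)^2 |e_(k-1)|^2 - 3/2 |p_k|^2
           + c_k <p_k, e_(k-1)>
   is chosen so that all terms in p_k and e_(k-1) telescope up to a factor
   decay(k) <= 1, and E V_k <= (3 + 18 / (k + 2)) D^2 + 14 sigma^2 / Lbar^2
   follows by induction from k = 2.  The residual at z_k is a combination of
   p_k, d_(k-1), e_(k-1) and F z_k - F z_(k-1); completing squares against
   monotonicity of F + A between z_k and z_* bounds it by V_k, |u|^2 and
   <e_(k-1), u>, the last of which has mean zero.

   H need not be separable, so sums and inner products of Borel maps into H need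
   not be measurable.  The noise is Bochner integrable, hence almost surely
   valued in a separable set; closing a countable set under F, the resolvents,
   the linear operations and the approximants of the noise gives a closed
   separable subspace that almost surely contains the whole trajectory. *)
Require Import Defs.
From HB Require Import structures.
From mathcomp Require Import all_boot all_order all_algebra finmap.
From mathcomp Require Import all_classical all_reals all_analysis.
From mathcomp Require Import measurable_realfun.
From mathcomp Require Import ring lra.

Set Implicit Arguments.
Unset Strict Implicit.
Unset Printing Implicit Defensive.

Import Order.TTheory GRing.Theory Num.Theory.
Import numFieldNormedType.Exports.

Local Open Scope classical_set_scope.
Local Open Scope ring_scope.

(** * Inequalities in an inner product space *)

Section inner_product.
Context {R : realType} {H : completeNormedModType R}.
Variable dot : {dot H for idfun}.

(** The error e_k is not centred given the past: only its fresh part is. Its inner products with p_k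
    and d_k therefore survive the expectation and have to be carried inside the potential. The
    schedules make them manageable. At x = k + 1 the ratio alpha_(k+1) / alpha_k is (x + 2) / (x +
    5/2); with it, beta_(k+1) - (alpha_(k+1) / alpha_k) beta_k is of order 1 / x^2, so the pull
    towards z_0 nearly cancels between consecutive steps, and 1 - gamma_(k+1) splits into linear
    factors. The cross term of the potential then dictates [decay].

    The velocity inequality behind the recursion is false at x = 1. This is why the induction starts
    at 2: its initial value and the residual at z_1 are estimated directly, using p_1 = -d_0 and
    beta_0 = 1. *)

Lemma dotDl x y z : dot (x + y) z = dot x z + dot y z.
Proof. exact: linearDl. Qed.

Lemma dotZl (a : R) x y : dot (a *: x) y = a * dot x y.
Proof. exact: linearZl_LR. Qed.

Lemma dotC x y : dot x y = dot y x.
Proof.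
by have := @hermitian_subproof _ _ false idfun dot x y; rewrite expr0 mul1r.
Qed.

Lemma dotDr x y z : dot z (x + y) = dot z x + dot z y.
Proof. exact: linearDr. Qed.

Lemma dotZr (a : R) x y : dot y (a *: x) = a * dot y x.
Proof. by rewrite dotC dotZl dotC. Qed.

Lemma dotNl x y : dot (- x) y = - dot x y.
Proof. exact: linearNl. Qed.

Lemma dotNr x y : dot y (- x) = - dot y x.
Proof. exact: linearNr. Qed.

Definition dotE := (dotDl, dotDr, dotNl, dotNr, dotZl, dotZr).

Lemma dot_ge0 x : 0 <= dot x x.
Proof.
have [->|x0] := eqVneq x 0; first by rewrite linear0l.
exact/ltW/neq0_dnorm_gt0.
Qed.

(* The coupling constants are tuned so that [p] and [e] drop out of the
   completed square in [D]. *)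
Lemma velocity_step (Q f ka chi G : R) (b e p n D : H) : 0 < Q ->
  dot D D <= dot D (b + (chi * ka / (2 * Q)) *: e - f *: p - n) ->
  (Q + Q * f) * dot D D + G * dot (ka *: e + n) (ka *: e + n)
    - Q * f * dot (p - D) (p - D) + chi * dot (p - D) (ka *: e + n) <=
  Q * dot b b + ((Q + chi / 2) ^+ 2 / Q + G) * dot n n
    + G * ka ^+ 2 * dot e e - Q * f * dot p p + chi * ka * dot p e
    + (- (2 * Q + chi) * dot n b + 2 * G * ka * dot n e + chi * dot n p).
Proof.
move=> Q0 hD; rewrite -subr_ge0.
set y := b + _ - _ - _ in hD.
set s := D - b + ((Q + chi / 2) / Q) *: n.
have h : 0 <= Q * dot s s + 2 * Q * (dot D y - dot D D).
  by rewrite addr_ge0 ?mulr_ge0 ?dot_ge0 ?subr_ge0 // ?ltW.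
apply: le_trans h _; rewrite le_eqVlt; apply/orP; left; apply/eqP.
rewrite /s /y !dotE.
rewrite ?(dotC b D) ?(dotC n D) ?(dotC b n) ?(dotC e D) ?(dotC e n) ?(dotC D p).
rewrite ?(dotC e p) ?(dotC n p).
by field; rewrite gt_eqF.
Qed.

(** The cross term [- 2 * r * dot f d] has the favourable sign, so the squares add without a Young
    constant. In the uses, [f] is a step of the monotone [F] along [d]. *)
Lemma damped_le (r a : R) (d f : H) : 0 <= r -> 0 <= dot f d ->
  dot f f <= a * dot d d ->
  dot (r *: d - f) (r *: d - f) <= (r ^+ 2 + a) * dot d d.
Proof.
move=> r0 fd ff; have := mulr_ge0 r0 fd; rewrite !dotE (dotC d f) => rfd.
lra.
Qed.

(** This is 2 <x, y> <= |x|^2 / 2 + 2 |y|^2. The smaller constant goes to the noise increment, which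
    competes with the velocity weight; the variance term carries the small factor [mixing ^+ 2] and
    tolerates 3. *)
Lemma young_le (x y : H) :
  dot (x + y) (x + y) <= 3 / 2 * dot x x + 3 * dot y y.
Proof.
have := dot_ge0 (x - 2 *: y); rewrite !dotE (dotC y x) => ?; lra.
Qed.

(* Applied with [t = 1 / (N + 2)], and with [x], [e] equal to [N + 2] times the
   damped velocity and the error; [mu] must not depend on the vectors, as the
   last term is removed by taking expectations. *)
Lemma residual_le (t c : R) : 0 <= t <= 1 / 4 -> 1 <= c <= 1 + 6 / 5 * t ->
  exists mu, forall x p e u, 0 <= dot (3 *: p - x - e) (u - p) ->
  dot (3 *: p - x - e) (3 *: p - x - e) <=
  11 / 5 * ((1 + 4 * t) * dot x x + dot e e - 3 / 2 * dot p p
            + 2 * c * dot p e)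
  + (131 / 4 - 11 / 5 * (3 + 18 * t)) * dot u u + mu * dot e u.
Proof.
move=> /andP[t0 t1] /andP[c0 c1].
(* Subtract 8 times the monotonicity inequality from the gap between the two sides. Its terms in [x]
   complete to the square [s1] of weight [g], which needs only that [1 / g] stays below the
   coefficient of |x|^2. What is left has coefficient [g1] on |e|^2, [2 * r1] on <p, e>, [P] on
   |p|^2 and [- 2 * P * eta] on <p, u>; [q] and [s2] complete these squares, and [mu] absorbs the
   remaining <e, u>. *)
pose g := 1 - 14 / 5 * t.
pose P := 117 / 10 - g.
pose eta := (12 - 4 * g) / P.
pose r1 := 11 / 5 * c - 1 - g.
pose g1 := 6 / 5 - g.
have g0 : 0 < g by rewrite /g; lra.
have P0 : 0 < P by rewrite /P /g; lra.
have g10 : 0 < g1 by rewrite /g1 /g; lra.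
have r10 : 0 <= r1 by rewrite /r1 /g; lra.
have r1g : r1 ^+ 2 <= g1 * P.
  rewrite /r1 /g1 /P /g; nra.
have A1 : 1 / g <= 11 / 5 * (1 + 4 * t) - 1.
  by rewrite ler_pdivrMr // /g; nra.
have Bu : 16 * g + P * eta ^+ 2 <= 131 / 4 - 11 / 5 * (3 + 18 * t).
  have -> : P * eta ^+ 2 = (12 - 4 * g) ^+ 2 / P.
    by rewrite /eta; field; rewrite gt_eqF.
  rewrite -lerBrDl ler_pdivrMr // /P /g; nra.
exists (- (8 + 8 * g) - 2 * r1 * eta) => x p e u h.
set Y := e + p - 4 *: u.
set s1 := g^-1 *: x - Y.
set q := p - eta *: u.
set s2 := e + (r1 / g1) *: q.
have h1 := mulr_ge0 (ltW g0) (dot_ge0 s1).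
have h2 := mulr_ge0 (ltW g10) (dot_ge0 s2).
have h3 : 0 <= (P - r1 ^+ 2 / g1) * dot q q.
  by rewrite mulr_ge0 ?dot_ge0 // subr_ge0 ler_pdivrMr // mulrC.
have h4 : 0 <= (11 / 5 * (1 + 4 * t) - 1 - 1 / g) * dot x x.
  by rewrite mulr_ge0 ?dot_ge0 // subr_ge0.
have h5 : 0 <= (131 / 4 - 11 / 5 * (3 + 18 * t) - (16 * g + P * eta ^+ 2))
    * dot u u by rewrite mulr_ge0 ?dot_ge0 // subr_ge0.
rewrite -subr_ge0.
set S := (X in _ <= X).
have -> : S = g * dot s1 s1 + g1 * dot s2 s2
    + (P - r1 ^+ 2 / g1) * dot q q
    + (11 / 5 * (1 + 4 * t) - 1 - 1 / g) * dot x x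
    + (131 / 4 - 11 / 5 * (3 + 18 * t) - (16 * g + P * eta ^+ 2)) * dot u u
    + 8 * dot (3 *: p - x - e) (u - p); last first.
  by rewrite !addr_ge0 // mulr_ge0.
move: (gt_eqF g0) (gt_eqF P0) (gt_eqF g10) => g0' P0' g10'.
rewrite /S /s1 /s2 /q /Y !dotE.
rewrite ?(dotC x e) ?(dotC x p) ?(dotC x u) ?(dotC p e) ?(dotC u p) ?(dotC u e).
have etaP : P * eta = 12 - 4 * g by rewrite /eta mulrC divfK // P0'.
have -> : P = 117 / 10 - g by [].
have g1E : g1 = 6 / 5 - g by [].
move: etaP; rewrite {1}/P => etaP.
have -> : t = (1 - g) * 5 / 14 by rewrite /g; field.
have -> : c = (r1 + 1 + g) * 5 / 11 by rewrite /r1; field.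
move: g1E etaP; rewrite -/g; clearbody g eta r1 => g1E etaP.
have {}g10' : 6 / 5 - g != 0 by rewrite -g1E g10'.
rewrite {}g1E; apply/eqP; rewrite -subr_eq0; apply/eqP.
transitivity (2 * ((117 / 10 - g) * eta - (12 - 4 * g)) * dot p u).
  field; rewrite g0' /=; apply: contraNneq g10' => h0; apply/eqP; lra.
by rewrite etaP subrr mulr0 mul0r.
Qed.

(** The case N = 1, where beta_0 = 1 and p_1 = -d_0, with [psi] the forward step. The coefficient
    1715/432 is exactly 35 theta_0 / 3, and 35/3 becomes the same number once E |e_0|^2 <= theta_0
    sigma^2 / Lbar^2 is inserted. With multipliers 4 and 5 for the two hypotheses, [s1] completes
    the square in [psi] and [s2] the one in [d]. *)
Lemma residual1_le (psi d e u : H) :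
  dot psi psi <= 49 / 144 * dot d d -> 0 <= dot (psi - d - e) (u + d) ->
  dot (psi - d - e) (psi - d - e) <=
  1715 / 432 * dot u u + 35 / 3 * dot e e - 215 / 151 * dot e u.
Proof.
move=> hpsi hW.
have h1 := dot_ge0 (4 *: psi - d + e - 2 *: u).
have h2 := dot_ge0 (d + (216 / 151) *: u + (180 / 151) *: e).
have h3 := dot_ge0 u; have h4 := dot_ge0 e.
set s1 := 4 *: psi - d + e - 2 *: u in h1.
set s2 := d + _ + _ in h2.
suff : 4 * dot (psi - d - e) (u + d)
  + 5 * (49 / 144 * dot d d - dot psi psi) + 1 / 4 * dot s1 s1
  + 151 / 144 * dot s2 s2 + (1715 / 432 - 1 - 324 / 151) * dot u u
  + (35 / 3 - 1 - 1 / 4 - 225 / 151) * dot e e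
  = 1715 / 432 * dot u u + 35 / 3 * dot e e - 215 / 151 * dot e u
    - dot (psi - d - e) (psi - d - e) by lra.
rewrite /s1 /s2 !dotE.
rewrite ?(dotC d psi) ?(dotC e psi) ?(dotC u psi) ?(dotC e d) ?(dotC u d)
  ?(dotC u e).
by field.
Qed.

(** Here [l] is L^2 / Lbar^2, and the left side is what one step from x = 1 leaves of V_2, apart
    from fresh variance. Its velocity coefficient depends on [l] since the [L] part enters through
    increments of [F] and the rest through the noise. The value 15/2 is 3 + 18/4, the first term of
    the inductive bound. *)
Lemma potential2_le (l : R) (psi d e u : H) : 0 <= l <= 1 ->
  dot psi psi <= 49 / 144 * l * dot d d -> 0 <= dot (psi - d - e) (u + d) ->
  (7 / 2 * l + 3241 / 384 * (1 - l) - 3 / 2) * dot d d + 25 / 4 * dot e e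
    - 13 / 2 * dot d e <=
  15 / 2 * dot u u + 34 * dot e e + 1169 / 841 * dot e u.
Proof.
move=> /andP[l0 l1] hpsi hW.
have h1 := dot_ge0 (psi - (16 / 29) *: (u + d)).
have h2 := dot_ge0 (d + (650 / 841) *: u + (1125 / 464) *: e).
have h3 := dot_ge0 u; have h4 := dot_ge0 e.
have h5 := mulr_ge0 l0 (dot_ge0 d).
have h6 := mulr_ge0 (_ : 0 <= 1 - l) (dot_ge0 d).
have {}h6 := h6 ltac:(by rewrite subr_ge0).
set s1 := psi - _ in h1.
set s2 := d + _ + _ in h2.
suff : 16 * dot (psi - d - e) (u + d)
  + 29 / 2 * (49 / 144 * l * dot d d - dot psi psi) + 29 / 2 * dot s1 s1
  + 116 / 25 * dot s2 s2
  + (- (7 / 2 * l + 3241 / 384 * (1 - l) - 3 / 2) + 16 - 1421 / 288 * l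
     - 128 / 29 - 116 / 25) * dot d d
  + (15 / 2 - 128 / 29 - 116 / 25 * (650 / 841) ^+ 2) * dot u u
  + (34 - 25 / 4 - 116 / 25 * (1125 / 464) ^+ 2) * dot e e
  = 15 / 2 * dot u u + 34 * dot e e + 1169 / 841 * dot e u
    - ((7 / 2 * l + 3241 / 384 * (1 - l) - 3 / 2) * dot d d
       + 25 / 4 * dot e e - 13 / 2 * dot d e) by lra.
rewrite /s1 /s2 !dotE.
rewrite ?(dotC d psi) ?(dotC e psi) ?(dotC u psi) ?(dotC e d) ?(dotC u d)
  ?(dotC u e).
by field.
Qed.

End inner_product.

(** * Step sizes and coefficients *)

Ltac pos_neq0 := do ?[apply/andP; split]; apply: lt0r_neq0; lra.

Section step_sizes.
Context {R : realType}.
Variable Lb : R.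
Hypothesis Lb_gt0 : 0 < Lb.

Definition theta (k : nat) : R := (alpha Lb k * Lb) ^+ 2.

Lemma alpha_gt0 k : 0 < alpha Lb k.
Proof.
elim: k => [|k IH] /=; first by rewrite divr_gt0 // mulr_gt0.
by rewrite mulr_gt0 // divr_gt0 // ?mulr_gt0 // ltr_wpDl // mulr_ge0.
Qed.

Lemma alphaS k : alpha Lb k.+1 = (k%:R + 3) / (k%:R + 7 / 2) * alpha Lb k.
Proof.
rewrite [LHS]/=; congr (_ * _).
have k0 : 0 <= k%:R :> R by [].
by field; pos_neq0.
Qed.

Lemma theta0 : theta 0 = 49 / 144.
Proof. by rewrite /theta /=; field; rewrite gt_eqF. Qed.

Lemma thetaS k :
  theta k.+1 = ((k%:R + 3) / (k%:R + 7 / 2)) ^+ 2 * theta k.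
Proof. by rewrite /theta alphaS; ring. Qed.

Lemma theta1 : theta 1 = 1 / 4.
Proof. by rewrite thetaS theta0; field. Qed.

Lemma theta_ge0 k : 0 <= theta k.
Proof. exact: sqr_ge0. Qed.

(* [theta k] is nonincreasing after multiplication by [k + 14/5] and
   nondecreasing after multiplication by [k + 11/4]. *)
Lemma theta_le k : theta k * (72 * (5 * k%:R + 14)) <= 343.
Proof.
elim: k => [|k IH]; first by rewrite theta0; lra.
apply: le_trans IH; rewrite thetaS mulrAC mulrC ler_wpM2l ?theta_ge0 //.
have k0 : 0 <= k%:R :> R by [].
rewrite expr_div_n mulrAC ler_pdivrMr; last by rewrite exprn_gt0 //; lra.
rewrite -natr1; nra.
Qed.

Lemma theta_ge k : 539 <= theta k * (144 * (4 * k%:R + 11)).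
Proof.
elim: k => [|k IH]; first by rewrite theta0; lra.
apply: (le_trans IH); rewrite thetaS [leRHS]mulrAC [leRHS]mulrC.
rewrite ler_wpM2l ?theta_ge0 //.
have k0 : 0 <= k%:R :> R by [].
rewrite expr_div_n mulrAC ler_pdivlMr; last by rewrite exprn_gt0 //; lra.
rewrite -natr1; nra.
Qed.

(** The origin of the constant 35: theta_k (k + 11/4) >= 539/576, and 35 * 539/576 = 32.7517...
    exceeds 131/4 by less than 1/500. *)
Lemma residual_weight k : 131 / 4 <= 35 * theta k * (k%:R + 3).
Proof.
have := theta_ge k; have k0 : 0 <= k%:R :> R by [].
have := theta_ge0 k; nra.
Qed.

End step_sizes.

Section coefficients.
Context {R : realType}.
Implicit Types x : R.

(** Forced by the cross term: one step leaves 2 (x + 9/4) in front of <p, e>, so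
    [decay x * cross_weight x] must equal that. The defect [1 - decay x], of order 1 / (2x), pays
    for the fresh noise. *)
Definition decay x := (x + 9 / 4) * (x + 1 / 2) / ((x + 5 / 4) * (x + 2)).

Definition velocity_weight x := (x + 3 / 2) * (x + 2) + 3 / 2.

(** The coefficient of |n|^2 in [velocity_step] for Q = (x + 5/2) (x + 3), chi =
    [cross_weight (x + 1)] and G = (x + 3)^2. *)
Definition noise_weight x :=
  (x + 3) ^+ 2 * ((x + 2) ^+ 2 * (x + 3) / ((x + 3 / 2) ^+ 2 * (x + 5 / 2)) + 1).

(** This is gamma_(k+1) at x = k + 1. One has 1 - mixing x = (x + 3/2) (x + 5/2) / ((x + 2) (x +
    3)), whose product with the step ratio (x + 2) / (x + 5/2) is [retention x]. *)
Definition mixing x := (x + 9 / 4) / ((x + 2) * (x + 3)).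

Definition cross_weight x := 2 * (x + 5 / 4) * (x + 2) / (x + 1 / 2).

Lemma decay_ge0 x : 0 <= x -> 0 <= decay x.
Proof. by move=> x0; rewrite divr_ge0 // mulr_ge0 //; lra. Qed.

Lemma noise_weightE x : 0 <= x ->
  noise_weight x * (1 - mixing x) ^+ 2 =
  (x + 5 / 2) * (x + 3) + ((x + 3 / 2) * (x + 5 / 2) / (x + 2)) ^+ 2.
Proof.
move=> x0; rewrite /noise_weight /mixing; field.
by pos_neq0.
Qed.

Lemma noise_weight_ge0 x : 0 <= x -> 0 <= noise_weight x.
Proof.
move=> x0; rewrite mulr_ge0 ?sqr_ge0 // addr_ge0 // divr_ge0 //;
  by rewrite mulr_ge0 ?sqr_ge0 //; lra.
Qed.

(** The left side is the velocity coefficient of the one-step bound once the [L] and [LDelta] parts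
    are merged into [th]. At x = 1 and th = 1/4 it would exceed the right side. *)
Lemma velocity_decay x th : 2 <= x -> 0 <= th -> th * (72 * (5 * x + 14)) <= 343 ->
  (x - 1) ^+ 2 * (x + 3) / (x + 5 / 2)
    + 3 / 2 * noise_weight x * (1 - mixing x) ^+ 2 * th <=
  decay x * velocity_weight x.
Proof.
move=> x2 th0 thx; rewrite -(mulrA (3 / 2)) noise_weightE; last lra.
pose th' := 343 / (72 * (5 * x + 14)).
have thth' : th <= th' by rewrite ler_pdivlMr //; lra.
have h0 : 0 <= 3 / 2 * ((x + 5 / 2) * (x + 3) + ((x + 3 / 2) * (x + 5 / 2) / (x + 2)) ^+ 2).
  by rewrite mulr_ge0 // ?addr_ge0 ?sqr_ge0 ?mulr_ge0 //; lra.
apply: (@le_trans _ _ ((x - 1) ^+ 2 * (x + 3) / (x + 5 / 2) +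
   3 / 2 * ((x + 5 / 2) * (x + 3) + ((x + 3 / 2) * (x + 5 / 2) / (x + 2)) ^+ 2) * th')).
  by rewrite lerD2l ler_wpM2l.
rewrite /decay /velocity_weight /th' -subr_ge0.
have y0 : 0 <= x - 2 by lra.
have y2 := exprn_ge0 2 y0; have y3 := exprn_ge0 3 y0.
have y4 := exprn_ge0 4 y0; have y5 := exprn_ge0 5 y0.
have y6 := exprn_ge0 6 y0.
(* The numerator after clearing denominators. Rewritten in powers of [x - 2], its positivity is a
   matter of linear arithmetic; the inequalities below use the same device. *)
set N := (x + 9 / 4) * (x + 1 / 2) * (x + 5 / 2) * (x + 2) * (5 * x + 14)
    * ((x + 3 / 2) * (x + 2) + 3 / 2)
  - ((x - 1) ^+ 2 * (x + 3) * (x + 5 / 4) * (x + 2) ^+ 2 * (5 * x + 14)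
     + 343 / 48 * ((x + 5 / 2) * (x + 3) * (x + 2) ^+ 2
                   + ((x + 3 / 2) * (x + 5 / 2)) ^+ 2)
       * (x + 5 / 2) * (x + 5 / 4)).
rewrite (_ : _ - _ =
    N / ((x + 5 / 2) * (x + 5 / 4) * (x + 2) ^+ 2 * (5 * x + 14))).
  rewrite divr_ge0 // ?mulr_ge0 ?exprn_ge0 //; rewrite ?/N; lra.
by rewrite /N; field; pos_neq0.
Qed.

(** Makes 14 sigma^2 / Lbar^2 an invariant level of the recursion: the fresh variance and
    [1 - decay x] are both of order 1 / x. *)
Lemma noise_decay x th : 2 <= x -> 0 <= th -> th * (72 * (5 * x + 14)) <= 343 ->
  3 * noise_weight x * th * mixing x ^+ 2 <= 14 * (1 - decay x).
Proof.
move=> x2 th0 thx.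
pose th' := 343 / (72 * (5 * x + 14)).
have thth' : th <= th' by rewrite ler_pdivlMr //; lra.
apply: (@le_trans _ _ (3 * noise_weight x * th' * mixing x ^+ 2)).
  by rewrite ler_wpM2r ?sqr_ge0 // ler_wpM2l // mulr_ge0 ?noise_weight_ge0 //; lra.
rewrite /decay /noise_weight /mixing /th' -subr_ge0.
have y0 : 0 <= x - 2 by lra.
have y2 := exprn_ge0 2 y0; have y3 := exprn_ge0 3 y0.
have y4 := exprn_ge0 4 y0; have y5 := exprn_ge0 5 y0.
have y6 := exprn_ge0 6 y0.
set N := 14 * ((x + 5 / 4) * (x + 2) - (x + 9 / 4) * (x + 1 / 2)) * (x + 2)
    * (x + 3 / 2) ^+ 2 * (x + 5 / 2) * (5 * x + 14)
  - 343 / 24 * ((x + 2) ^+ 2 * (x + 3) + (x + 3 / 2) ^+ 2 * (x + 5 / 2))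
    * (x + 9 / 4) ^+ 2 * (x + 5 / 4).
rewrite (_ : _ - _ = N / ((x + 5 / 4) * (x + 2) ^+ 2 * (x + 3 / 2) ^+ 2
                          * (x + 5 / 2) * (5 * x + 14))).
  rewrite divr_ge0 // ?mulr_ge0 ?exprn_ge0 //; rewrite ?/N; lra.
by rewrite /N; field; pos_neq0.
Qed.

Lemma error_decay x : 2 <= x -> (x + 3 / 2) ^+ 2 <= decay x * (x + 2) ^+ 2.
Proof.
move=> x2; rewrite -subr_ge0 /decay.
have -> : (x + 9 / 4) * (x + 1 / 2) / ((x + 5 / 4) * (x + 2)) * (x + 2) ^+ 2
  - (x + 3 / 2) ^+ 2 = (1 / 2 * x ^+ 2 + 5 / 8 * x - 9 / 16) / (x + 5 / 4).
  by field; pos_neq0.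
by rewrite divr_ge0 //; nra.
Qed.

(** The quantity [3 + 18 / (x + 2)] starts at 15/2 for x = 2, the value that the first step
    provides, and decreases to 3. Since [decay x] is below 1 by about 1 / (2x), it shrinks fast
    enough. *)
Lemma distance_decay x : 2 <= x ->
  decay x * (3 + 18 / (x + 2)) <= 3 + 18 / (x + 3).
Proof.
move=> x2; rewrite -subr_ge0.
rewrite /decay.
have y0 : 0 <= x - 2 by lra.
have y2 := exprn_ge0 2 y0; have y3 := exprn_ge0 3 y0.
set N := (3 * (x + 3) + 18) * (x + 5 / 4) * (x + 2) ^+ 2
  - (x + 9 / 4) * (x + 1 / 2) * (3 * (x + 2) + 18) * (x + 3).
rewrite (_ : _ - _ = N / ((x + 3) * (x + 5 / 4) * (x + 2) ^+ 2)).
  rewrite divr_ge0 // ?mulr_ge0 ?exprn_ge0 //; rewrite ?/N; lra.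
by rewrite /N; field; pos_neq0.
Qed.

(** With t = 1 / (x + 2), the factor (x + 2) (x + 6) is (1 + 4t) (x + 2)^2, the weight of the damped
    velocity in [residual_le]. The hypothesis has 5x + 9 and not 5x + 14 because it is met by theta
    at k = x - 1. *)
Lemma velocity_weight_ge x th : 2 <= x -> 0 <= th ->
  th * (72 * (5 * x + 9)) <= 343 ->
  (x + 2) * (x + 6) * (((x - 1) / (x + 2)) ^+ 2 + th) <= velocity_weight x.
Proof.
move=> x2 th0 thx.
pose th' := 343 / (72 * (5 * x + 9)).
have thth' : th <= th' by rewrite ler_pdivlMr //; lra.
apply: (@le_trans _ _ ((x + 2) * (x + 6) * (((x - 1) / (x + 2)) ^+ 2 + th'))).
  by rewrite ler_wpM2l ?lerD2l // mulr_ge0 //; lra.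
rewrite /velocity_weight /th' -subr_ge0.
have y0 : 0 <= x - 2 by lra.
have y2 := exprn_ge0 2 y0; have y3 := exprn_ge0 3 y0.
set N := ((x + 3 / 2) * (x + 2) + 3 / 2) * (x + 2) * (5 * x + 9)
  - ((x + 6) * (x - 1) ^+ 2 * (5 * x + 9)
     + 343 / 72 * (x + 6) * (x + 2) ^+ 2).
rewrite (_ : _ - _ = N / ((x + 2) * (5 * x + 9))).
  rewrite divr_ge0 // ?mulr_ge0 ?exprn_ge0 //; rewrite ?/N; lra.
by rewrite /N; field; pos_neq0.
Qed.

End coefficients.

(** * Separable hulls and strong measurability *)

Section separable_hull.
Context {R : realType} {H : completeNormedModType R}.

Definition closure_seq (c : nat -> H) : set H :=
  [set x | forall e, 0 < e -> exists n, `|x - c n| < e].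

Lemma natSinv_lt (e : R) : 0 < e -> exists n : nat, n.+1%:R^-1 < e.
Proof.
move=> e0; have [m _ /(_ m (leqnn _))] := near_infty_natSinv_lt (PosNum e0).
by exists m.
Qed.

(** The hull consists of the values of all finite terms over the countable signature [I], enumerated
    by the pickling of generic trees. Only binary nodes headed by a leaf count as applications;
    every other tree denotes [x0]. *)
Lemma countable_hull {T : Type} {I : countType} (op : I -> T -> T -> T) (x0 : T) :
  exists2 c : nat -> T, exists n, c n = x0
    & forall i m n, exists j, c j = op i (c m) (c n).
Proof.
pose fix val (t : GenTree.tree I) : T :=
  match t with
  | GenTree.Node _ [:: GenTree.Leaf i; a; b] => op i (val a) (val b)
  | _ => x0
  end.
pose c n := oapp val x0 (@choice.unpickle (GenTree.tree I) n).
have cP t : c (choice.pickle t) = val t by rewrite /c choice.pickleK.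
exists c; first by exists (choice.pickle (GenTree.Node 0 [::] : GenTree.tree I)); rewrite cP.
move=> i m n.
have valP k : exists t, c k = val t.
  rewrite /c; case: choice.unpickle => [t|] /=; first by exists t.
  by exists (GenTree.Node 0 [::]).
have [a ->] := valP m; have [b ->] := valP n.
by exists (choice.pickle (GenTree.Node 0 [:: GenTree.Leaf i; a; b])); rewrite cP.
Qed.

(* The partial nonexpansive maps are only known to be defined somewhere, so the
   hull is closed under their values at points of the domain that are chosen
   close to its elements. *)
Lemma separable_hull (L : R) (F : H -> H) (rel : nat -> H -> H -> Prop)
    (w : H -> nat -> H) (z0 : H) :
  L.-lipschitz F ->
  (forall k x x' y y', rel k x y -> rel k x' y' -> `|y - y'| <= `|x - x'|) ->
  exists c : nat -> H, let K := closure_seq c in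
  [/\ K z0, forall x y, K x -> K y -> K (x + y),
      forall a x, K x -> K (a *: x),
      forall x, K x -> K (F x) &
      (forall k x y, K x -> rel k x y -> K y) /\
      (forall m i, exists j, c j = w (c m) i)].
Proof.
move=> Flip reln.
pose J k x m := get [set y | exists2 x', rel k x' y & `|x' - x| < m.+1%:R^-1].
pose op (i : unit + rat + unit + nat * nat + nat) (x y : H) : H :=
  match i with
  | inl (inl (inl (inl _))) => x + y
  | inl (inl (inl (inr q))) => ratr q *: x
  | inl (inl (inr _)) => F x
  | inl (inr km) => J km.1 x km.2
  | inr i => w x i
  end.
have [c [n0 cn0] cop] := countable_hull op z0.
have Kc n : closure_seq c (c n) by move=> e e0; exists n; rewrite subrr normr0.
exists c => K; split.
- by rewrite /K -cn0.
- move=> x y Kx Ky e e0; have e2 : 0 < e / 2 by rewrite divr_gt0.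
  have [m xm] := Kx _ e2; have [n yn] := Ky _ e2.
  have [j cj] := cop (inl (inl (inl (inl tt)))) m n.
  exists j; rewrite cj /= opprD addrACA (le_lt_trans (ler_normD _ _)) //.
  by rewrite [e]splitr ltrD.
- move=> a x Kx e e0.
  have x1 : 0 < `|x| + 1 by rewrite ltr_wpDl.
  have [q] : exists q : rat, `|a - ratr q| < Num.min 1 (e / 2 / (`|x| + 1)).
    set r := Num.min _ _; have r0 : 0 < r by rewrite lt_min ltr01 !divr_gt0.
    have [|q] := @rat_in_itvoo R (a - r) (a + r); first by lra.
    rewrite in_itv /= => /andP[q1 q2]; exists q.
    by rewrite ltr_norml; apply/andP; split; lra.
  rewrite lt_min => /andP[q1 q2].
  have q0 : 0 < `|ratr q : R| + 1 by rewrite ltr_wpDl.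
  have [|n xn] := Kx (e / 2 / (`|ratr q : R| + 1)); first by rewrite !divr_gt0.
  have [j cj] := cop (inl (inl (inl (inr q)))) n n.
  exists j; rewrite cj /=; move: (ratr q : R) q2 q0 xn => r q2 q0 xn.
  have -> : a *: x - r *: c n = (a - r) *: x + r *: (x - c n).
    by rewrite scalerBl scalerBr addrA subrK.
  rewrite (le_lt_trans (ler_normD _ _)) // !normrZ [e]splitr ltr_leD //.
    rewrite ltr_pdivlMr // in q2; apply: le_lt_trans q2.
    by apply: ler_wpM2l => //; rewrite lerDl.
  rewrite ltr_pdivlMr // in xn; apply: le_trans (ltW xn).
  by rewrite [leLHS]mulrC; apply: ler_wpM2l => //; rewrite lerDl.
- move=> x Kx e e0.
  have L1 : 0 < `|L| + 1 by rewrite ltr_wpDl.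
  have [|n xn] := Kx (e / (`|L| + 1)); first by rewrite divr_gt0.
  have [j cj] := cop (inl (inl (inr tt))) n n.
  exists j; rewrite cj /=.
  have /= := Flip (x, c n) (conj I I).
  move/le_lt_trans; apply; rewrite ltr_pdivlMr // in xn; apply: le_lt_trans xn.
  rewrite [leLHS]mulrC; apply: ler_wpM2l => //.
  by rewrite (le_trans (ler_norm _)) // lerDl.
- split; last first.
    by move=> m i; have [j cj] := cop (inr i) m m; exists j.
  move=> k x y Kx xy e e0.
  have e2 : 0 < e / 2 by rewrite divr_gt0.
  have [m me] := natSinv_lt e2.
  have [//|n xn] := Kx m.+1%:R^-1.
  have [j cj] := cop (inl (inr (k, m))) n n.
  (* The point [x] itself shows that the set is nonempty, so [get] returns one of its elements. This
     is the image of some [x'] that may differ from [x] but lies within 2 / (m + 1) of it. *)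
  have [x' x'y x'n] : [set y | exists2 x', rel k x' y & `|x' - c n| < m.+1%:R^-1]
      (J k (c n) m).
    by apply: (@getPex _ _); exists y; exists x.
  exists j; rewrite cj /=; apply: le_lt_trans (reln _ _ _ _ _ xy x'y) _.
  rewrite -[x - x'](subrKA (c n)) (le_lt_trans (ler_normD _ _)) //.
  by rewrite [e]splitr ltrD ?(lt_trans xn) // distrC (lt_trans x'n).
Qed.

End separable_hull.

Section strong_measurability.
Context {R : realType} {H : completeNormedModType R}.
Variable c : nat -> H.
Let K := closure_seq c.

(* Sums of Borel maps into a nonseparable space need not be Borel, so
   measurability is paired with values in the separable set [K]. *)
Definition meas_in {d} {T : measurableType d} (D : set T) (X : T -> H) :=
  measurable_fun D (X : T -> borel H) /\ forall w, D w -> K (X w).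

(** Separability replaces the measurability of sums: the preimage of [O] is the union, over those
    triples (i, j, n) that are [good], of the events that X and Y are 1 / (n + 1)-close to [c i] and
    [c j]. The condition [good] is only an index set of a countable union, so it need not be
    measurable. *)
Lemma preimage_open_measurable {d} {T : measurableType d} {V : normedModType R}
    (D : set T) (C : R) (X Y : T -> H) (Z : T -> V) :
  measurable D -> meas_in D X -> meas_in D Y ->
  (forall w w', D w -> D w' ->
    `|Z w - Z w'| <= C * (`|X w - X w'| + `|Y w - Y w'|)) ->
  forall O, open O -> measurable (D `&` Z @^-1` O).
Proof.
move=> mD [mX XK] [mY YK] ZXY O oO.
pose good i j n := forall w, D w -> `|c i - X w| < n.+1%:R^-1 ->
  `|c j - Y w| < n.+1%:R^-1 -> O (Z w).
pose E i j n := (D `&` X @^-1` ball (c i) n.+1%:R^-1)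
  `&` (D `&` Y @^-1` ball (c j) n.+1%:R^-1).
have -> : D `&` Z @^-1` O =
    \bigcup_i \bigcup_j \bigcup_(n in [set n | good i j n]) E i j n.
  apply/seteqP; split => [w [Dw OZw]|w [i _ [j _ [n gn [[Dw wX] [_ wY]]]]]].
    have [e /= e0 eO] : exists2 e : R, 0 < e & ball (Z w) e `<=` O.
      by have /nbhs_ballP[e e0 eO] := open_nbhs_nbhs (conj oO OZw); exists e.
    have C0 : 0 < 4 * (`|C| + 1) by rewrite mulr_gt0 // ltr_wpDl.
    have [n nC] := natSinv_lt (divr_gt0 e0 C0).
    have n0 : 0 < n.+1%:R^-1 :> R by [].
    have [i Xi] := XK _ Dw _ n0; have [j Yj] := YK _ Dw _ n0.
    exists i => //; exists j => //; exists n; last first.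
      by split; split => //; rewrite /= -ball_normE /ball_ /= distrC.
    move=> w' Dw' Xw' Yw'; apply: eO; rewrite -ball_normE /ball_ /=.
    apply: le_lt_trans (ZXY _ _ Dw Dw') _.
    rewrite ltr_pdivlMr // in nC; apply: le_lt_trans nC.
    have hX : `|X w - X w'| <= 2 * n.+1%:R^-1.
      rewrite -[_ - _](subrKA (c i)) (le_trans (ler_normD _ _)) //.
      by rewrite mulr_natl mulr2n lerD // ltW.
    have hY : `|Y w - Y w'| <= 2 * n.+1%:R^-1.
      rewrite -[_ - _](subrKA (c j)) (le_trans (ler_normD _ _)) //.
      by rewrite mulr_natl mulr2n lerD // ltW.
    apply: (@le_trans _ _ (`|C| * (`|X w - X w'| + `|Y w - Y w'|))).
      by rewrite ler_wpM2r ?addr_ge0 // ler_norm.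
    apply: (@le_trans _ _ (`|C| * (4 * n.+1%:R^-1))).
      rewrite ler_wpM2l //; move: hX hY; set r := n.+1%:R^-1 => hX hY; lra.
    rewrite mulrC [4 * _]mulrC -mulrA ler_wpM2l // ler_wpM2l //.
    by rewrite lerDl.
  by split => //; apply: gn => //; [move: wX|move: wY]; rewrite /= -ball_normE.
do 2 (apply: bigcupT_measurable => ?).
apply: bigcup_measurable => n _; apply: measurableI; [apply: mX|apply: mY] => //;
  apply: sub_sigma_algebra; exact: ball_open.
Qed.

Lemma meas_in_lip2 {d} {T : measurableType d} (D : set T) (C : R)
    (X Y Z : T -> H) :
  measurable D -> meas_in D X -> meas_in D Y -> (forall w, D w -> K (Z w)) ->
  (forall w w', D w -> D w' ->
    `|Z w - Z w'| <= C * (`|X w - X w'| + `|Y w - Y w'|)) ->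
  meas_in D Z.
Proof.
move=> mD mX mY ZK ZXY; split => //.
apply: (@measurability _ _ _ (borel H) D Z (@open H)) => //.
move=> _ [U oU <-].
exact: preimage_open_measurable ZXY _ oU.
Qed.

Lemma meas_in_lip {d} {T : measurableType d} (D : set T) (C : R) (X Z : T -> H) :
  0 <= C -> measurable D -> meas_in D X -> (forall w, D w -> K (Z w)) ->
  (forall w w', D w -> D w' -> `|Z w - Z w'| <= C * `|X w - X w'|) ->
  meas_in D Z.
Proof.
move=> C0 mD mX ZK ZX; apply: (meas_in_lip2 (C := C) mD mX mX) => // w w' Dw Dw'.
by rewrite (le_trans (ZX _ _ Dw Dw')) // ler_wpM2l // lerDl.
Qed.

Lemma meas_in_cst {d} {T : measurableType d} (D : set T) (x : H) :
  K x -> meas_in D (fun=> x).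
Proof. by move=> Kx; split => // mD; exact: measurable_cst. Qed.

Lemma meas_inS {d} {T : measurableType d} (D D' : set T) (X : T -> H) :
  measurable D' -> D `<=` D' -> meas_in D' X -> meas_in D X.
Proof.
move=> mD' DD' [mX XK]; split; first exact: measurable_funS mX.
by move=> w /DD'; exact: XK.
Qed.

Lemma meas_in_eq {d} {T : measurableType d} (D : set T) (X Y : T -> H) :
  (forall w, D w -> X w = Y w) -> meas_in D X -> meas_in D Y.
Proof.
move=> XY [mX XK]; split; last by move=> w Dw; rewrite -XY //; exact: XK.
by apply: eq_measurable_fun mX => w /[!inE] /XY.
Qed.

Lemma meas_in_comp {d d'} {T : measurableType d} {T' : measurableType d'}
    (g : T' -> T) (D : set T) (X : T -> H) : measurable_fun setT g ->
  measurable D -> meas_in D X -> meas_in (g @^-1` D) (X \o g).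
Proof.
move=> mg mD [mX XK]; split; last by move=> w; exact: XK.
apply: (measurable_comp mD _ mX) => //; first by move=> _ [w Dw <-].
exact: measurable_funTS.
Qed.

Lemma meas_in_norm {d} {T : measurableType d} (D : set T) (X : T -> H) :
  measurable D -> meas_in D X -> measurable_fun D (fun w => `|X w|).
Proof.
move=> mD mX; apply: (measurability _ (RGenOpens.measurableE R)).
move=> _ [_ [a [b ->] <-]].
apply: (preimage_open_measurable (V := R^o) (C := 1) mD mX mX) => //.
  by move=> w w' Dw Dw'; rewrite mul1r (le_trans (ler_dist_dist _ _)) // lerDl.
Qed.

Hypothesis KD : forall x y, K x -> K y -> K (x + y).
Hypothesis KZ : forall a x, K x -> K (a *: x).

Lemma meas_inD {d} {T : measurableType d} (D : set T) (X Y : T -> H) :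
  measurable D -> meas_in D X -> meas_in D Y -> meas_in D (fun w => X w + Y w).
Proof.
move=> mD mX mY; apply: (meas_in_lip2 (C := 1) mD mX mY).
  by move=> w Dw; apply: KD; [exact: mX.2|exact: mY.2].
by move=> w w' _ _; rewrite mul1r opprD addrACA ler_normD.
Qed.

Lemma meas_inZ {d} {T : measurableType d} (D : set T) (a : R) (X : T -> H) :
  measurable D -> meas_in D X -> meas_in D (fun w => a *: X w).
Proof.
move=> mD mX; apply: (meas_in_lip (C := `|a|) _ mD mX) => //.
  by move=> w Dw; apply: KZ; exact: mX.2.
by move=> w w' _ _; rewrite -scalerBr normrZ.
Qed.

Lemma meas_inN {d} {T : measurableType d} (D : set T) (X : T -> H) :
  measurable D -> meas_in D X -> meas_in D (fun w => - X w).
Proof.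
by move=> mD mX; under eq_fun do rewrite -scaleN1r; exact: meas_inZ.
Qed.

Lemma meas_inB {d} {T : measurableType d} (D : set T) (X Y : T -> H) :
  measurable D -> meas_in D X -> meas_in D Y -> meas_in D (fun w => X w - Y w).
Proof. by move=> mD mX mY; apply: meas_inD => //; exact: meas_inN. Qed.

Variable dot : {dot H for idfun}.
Hypothesis Hdot : hilbert_norm dot.

Lemma polarization x y :
  dot x y = 1 / 4 * (`|x + y| ^+ 2 - `|x - y| ^+ 2).
Proof. by rewrite -!Hdot !dotE (dotC dot y x); field. Qed.

Lemma meas_in_dot {d} {T : measurableType d} (D : set T) (X Y : T -> H) :
  measurable D -> meas_in D X -> meas_in D Y ->
  measurable_fun D (fun w => dot (X w) (Y w)).
Proof.
move=> mD mX mY; under eq_fun do rewrite polarization.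
apply: measurable_funM; first exact: measurable_cst.
apply: measurable_funB; apply: measurable_funX; apply: meas_in_norm => //.
  exact: meas_inD.
exact: meas_inB.
Qed.

End strong_measurability.

(** * The past of the samples *)

Section past.
Context {R : realType} {dO dS : measure_display}.
Context {Omega : measurableType dO} {S : measurableType dS}.
Variables (mu : probability S R) (P : probability Omega R).
Variable xi : nat -> {mfun Omega >-> S}.

Definition past_generator (k : nat) : set (set Omega) :=
  [set E | (exists (J : {fset nat}) (B : nat -> set S),
     [/\ forall i, i \in J -> (i < k)%N, forall i, measurable (B i)
       & E = \bigcap_(i in [set` J]) (xi i @^-1` B i)])
   \/ measurable E /\ P E = 0%E].

(* Null sets are included so that a set of full measure lies in every past. *)
Notation past k := (g_sigma_algebraType (past_generator k)).

Lemma preimage_measurable i B : measurable B -> measurable (xi i @^-1` B).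
Proof. by move=> mB; rewrite -[X in measurable X]setTI; exact: measurable_funP. Qed.

Lemma past_generator_measurable k : past_generator k `<=` measurable.
Proof.
move=> _ [[J [B [_ mB ->]]]|[]//].
by apply: bigcap_measurableType => i _; exact: preimage_measurable.
Qed.

Lemma past_generatorI k : setI_closed (past_generator k).
Proof.
move=> A A' GA GA'; have mA := past_generator_measurable GA.
have mA' := past_generator_measurable GA'.
case: GA => [[J [B [Jk mB AE]]]|[_ A0]]; last first.
  right; split; first exact: measurableI.
  by apply: (subset_measure0 _ mA _ A0) => //; exact: measurableI.
case: GA' => [[J' [B' [Jk' mB' AE']]]|[_ A0]]; last first.
  right; split; first exact: measurableI.
  by apply: (subset_measure0 _ mA' _ A0) => //; exact: measurableI.
left; exists (J `|` J')%fset.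
exists (fun i => (if i \in J then B i else setT) `&`
                 (if i \in J' then B' i else setT)).
split.
- by move=> i; rewrite in_fsetU => /orP[/Jk|/Jk'].
- by move=> i; apply: measurableI; case: ifP.
- rewrite {}AE {}AE'; apply/seteqP; split => [w [wB wB'] i _|w wB].
    by split; case: ifP => // iJ; [exact: wB|exact: wB'].
  split => i /= iJ; have := wB i; rewrite /= in_fsetU iJ ?orbT => /(_ isT) [];
    by [].
Qed.

Lemma past_sub k A : measurable (A : set (past k)) -> measurable (A : set Omega).
Proof.
move=> mA; exact: (smallest_sub (@sigma_algebra_measurable _ Omega)
  (@past_generator_measurable k)).
Qed.

Lemma past_mono k A :
  measurable (A : set (past k)) -> measurable (A : set (past k.+1)).
Proof.
move=> mA; apply: (smallest_sub (@sigma_algebra_measurable _ (past k.+1)) _ mA).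
move=> E [[J [B [Jk mB ->]]]|EN]; apply: sub_sigma_algebra; last by right.
by left; exists J, B; split => // i /Jk; exact: ltnW.
Qed.

Lemma past_null k A : measurable A -> P A = 0%E -> measurable (A : set (past k)).
Proof. by move=> mA A0; apply: sub_sigma_algebra; right. Qed.

Lemma past_xi k : measurable_fun setT (xi k : past k.+1 -> S).
Proof.
move=> _ B mB; rewrite setTI; apply: sub_sigma_algebra; left.
exists [fset k]%fset, (fun=> B); split => //; first by move=> i /fset1P ->.
apply/seteqP; split => [w wB i /= /fset1P -> //|w /(_ k)].
by apply; rewrite /= in_fset1.
Qed.

Hypothesis xi_law : forall i B, measurable B -> distribution P (xi i) B = mu B.
Hypothesis xi_indep : mutually_independent P xi.

(** As functions of [A] both sides are finite measures. They agree on the generators, which are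
    stable under intersection: on cylinders by independence, on null sets because both vanish.
    Uniqueness of measures extends this to the whole past. *)
Lemma past_independent k (A : set (past k)) B : measurable A -> measurable B ->
  P (A `&` xi k @^-1` B) = (P A * mu B)%E.
Proof.
move=> mA mB; have mxB := preimage_measurable k mB.
have muB : (mu B = (fine (mu B))%:E)%E by rewrite fineK // fin_num_measure.
have [r rE] : exists r : {nonneg R}, r%:num = fine (mu B).
  by exists (NngNum (fine_ge0 (measure_ge0 mu B))).
have := g_sigma_algebra_measure_unique (past_generator k)
  (@past_generator_measurable k) (fun=> setT) _ _
  (mrestr P mxB) (mscale r P) (@past_generatorI k) _ _ A mA.
rewrite /= /mrestr /mscale rE -muB muleC; apply.
- move=> _; left; exists fset0, (fun=> setT); split => //.
  by apply/seteqP; split => // w _ i /=; rewrite in_fset0.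
- by rewrite bigcup_const //; exists 0%N.
- move=> {mA}A [[J [C [Jk mC ->]]]|[mA A0]].
    have kJ : k \notin J by apply/negP => /Jk; rewrite ltnn.
    pose C' i := if i == k then B else C i.
    have mC' i : measurable (C' i) by rewrite /C'; case: ifP.
    have C'C i : i \in J -> C' i = C i.
      by rewrite /C'; case: eqP => // -> ; rewrite (negbTE kJ).
    have -> : \bigcap_(i in [set` J]) (xi i @^-1` C i) `&` xi k @^-1` B =
        \bigcap_(i in [set` (k |` J)%fset]) (xi i @^-1` C' i).
      apply/seteqP; split => [w [wC wB] i /= /fset1UP[->|iJ]|w wC].
      + by rewrite /C' eqxx.
      + by rewrite C'C //; exact: wC.
      + split => [i iJ|]; first by rewrite -C'C //; apply: wC; rewrite /= fset1Ur.
        by have := wC k; rewrite /C' eqxx; apply; rewrite /= fset1U1.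
    rewrite !xi_indep // big_fsetU1 //= {1}/C' eqxx.
    rewrite -[P (xi k @^-1` B)]/(distribution P (xi k) B) xi_law //; congr (_ * _)%E.
    by rewrite xi_indep //; apply: eq_big_seq => i /C'C ->.
  apply: (@etrans _ _ 0%E); last by rewrite -(mule0 (mu B)) -A0.
  apply: (subset_measure0 _ mA _ A0) => //; exact: measurableI.
- by move=> _; rewrite /mrestr setTI -ge0_fin_numE // fin_num_measure.
Qed.

Lemma measurable_past_id k : measurable_fun setT (id : Omega -> past k).
Proof. by move=> _ A mA; rewrite setTI; exact: (@past_sub k A mA). Qed.

(** Plays the role of conditioning on the past: the joint law of the past and the fresh sample is a
    product, so the sample is integrated out with the past frozen. The map [idk] is the identity of
    [Omega], read as a random variable with values in the past sigma-algebra. *)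
Lemma past_tonelli k (f : past k * S -> \bar R) :
  measurable_fun setT f -> (forall p, 0 <= f p)%E ->
  (\int[P]_w f (w, xi k w) = \int[P]_w \int[mu]_s f (w, s))%E.
Proof.
move=> mf f0.
pose idM := isMeasurableFun.Build _ _ _ _ (id : Omega -> past k)
  (@measurable_past_id k).
pose idk : {mfun Omega >-> past k} := HB.pack (id : Omega -> past k) idM.
have mg : measurable_fun setT ((fun w => (w, xi k w)) : Omega -> past k * S).
  by apply: measurable_fun_pair => //; exact: measurable_past_id.
pose gM := isMeasurableFun.Build _ _ _ _
  ((fun w => (w, xi k w)) : Omega -> past k * S) mg.
pose g : {mfun Omega >-> (past k * S)%type} :=
  HB.pack ((fun w => (w, xi k w)) : Omega -> past k * S) gM.
transitivity (\int[distribution P g]_p f p)%E.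
  by rewrite ge0_integral_pushforward // => p _; exact: f0.
transitivity (\int[distribution P idk \x mu]_p f p)%E.
  apply: eq_measure_integral => A mA _.
  apply: esym; apply: product_measure_unique => // B C mB mC.
  exact: (@past_independent k B C mB mC).
rewrite fubini_tonelli1 // /fubini_F ge0_integral_pushforward //.
- exact: measurable_fun_fubini_tonelli_F.
- by move=> p _; exact: integral_ge0.
Qed.

End past.

(** * Integrals of the noise *)

Section integrals.
Context {R : realType} {d} {T : measurableType d}.
Variable mu : {measure set T -> \bar R}.
Import HBNNSimple.

(* The integral of a nonnegative function is a supremum over simple minorants,
   so no measurability is needed. *)
Lemma le_integralT (f g : T -> \bar R) : (forall x, 0 <= f x)%E ->
  (forall x, f x <= g x)%E -> (\int[mu]_x f x <= \int[mu]_x g x)%E.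
Proof.
move=> f0 fg; have g0 x : (0 <= g x)%E by exact: le_trans (fg x).
rewrite !ge0_integralTE //; apply: ereal_sup_le => _ [h /= hf <-].
by exists h => //= x; exact: le_trans (fg x).
Qed.

Lemma markov_set (N : set T) (a : R) (f : T -> \bar R) : measurable N ->
  0 <= a -> (forall x, 0 <= f x)%E -> (forall x, N x -> a%:E <= f x)%E ->
  (a%:E * mu N <= \int[mu]_x f x)%E.
Proof.
move=> mN a0 f0 fN; rewrite -(setIT N) -integral_indic // -ge0_integralZl //.
- apply: le_integralT => x; first by rewrite mule_ge0 ?lee_fin.
  rewrite indicE; have [/set_mem xN|_] := boolP (x \in N).
    by rewrite mule1; exact: fN.
  by rewrite mule0.
- by apply/measurable_EFinP; exact: measurable_indic.
Qed.

End integrals.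

Section borel_functions.
Context {R : realType} {H : completeNormedModType R}.

Lemma borel_lip {d} {T : measurableType d} (D : set T) (C : R) (X : T -> H)
    (h : H -> R) :
  measurable_fun D (X : T -> borel H) ->
  (forall x y, `|h x - h y| <= C * `|x - y|) ->
  measurable_fun D (fun w => h (X w)).
Proof.
move=> mX hC; apply: (@measurableT_comp _ _ _ _ (borel H) _ (h : borel H -> R)) => //.
apply: (measurability _ (RGenOpens.measurableE R)) => _ [_ [a [b ->] <-]].
rewrite setTI; apply: sub_sigma_algebra.
have ch : continuous h.
  move=> x; apply/(@cvgrPdist_lt _ _ _ (nbhs x)) => e e0; near=> y.
  apply: le_lt_trans (hC _ _) _.
  apply: (@le_lt_trans _ _ ((`|C| + 1) * `|x - y|)).
    by rewrite ler_wpM2r // (le_trans (ler_norm _)) // lerDl.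
  rewrite mulrC -ltr_pdivlMr ?ltr_wpDl //; near: y.
  apply: (@cvgr_dist_lt _ _ _ _ _ id x); first exact: cvg_id.
  by rewrite divr_gt0 ?ltr_wpDl.
by apply: (open_comp (fun x _ => ch x)); exact: interval_open.
Unshelve. all: by end_near. Qed.

Variable dot : {dot H for idfun}.
Hypothesis Hdot : hilbert_norm dot.

(** Cauchy-Schwarz: the vector |y| x - s |x| y has nonnegative square for s = 1 and s = -1, and the
    two signs bound the inner product from both sides. *)
Lemma normr_dot_le x y : `|dot x y| <= `|x| * `|y|.
Proof.
have [->|x0] := eqVneq x 0; first by rewrite linear0l !normr0 mul0r.
have nx : 0 < `|x| by rewrite normr_gt0.
have key s : s ^+ 2 = 1 -> s * dot x y <= `|x| * `|y|.
  move=> s1; have := dot_ge0 dot (`|y| *: x - (s * `|x|) *: y).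
  have -> : dot (`|y| *: x - (s * `|x|) *: y) (`|y| *: x - (s * `|x|) *: y) =
    2 * (`|x| * `|y|) * (`|x| * `|y| - s * dot x y)
      + (s ^+ 2 - 1) * (`|x| * `|y|) ^+ 2.
    by rewrite !dotE !Hdot (dotC dot y x); ring.
  rewrite s1 subrr mul0r addr0.
  have [->|y0] := eqVneq y 0; first by rewrite linear0r mulr0 normr0 mulr0.
  rewrite pmulr_rge0 ?subr_ge0 //.
  by rewrite mulr_gt0 ?mulr_gt0 // normr_gt0.
have := key 1; have := key (-1); rewrite sqrrN expr1n => /(_ erefl) h1 /(_ erefl) h2.
by rewrite ler_norml; apply/andP; split; lra.
Qed.

End borel_functions.

Section weak_mean.
Context {R : realType} {H : completeNormedModType R}.
Variable dot : {dot H for idfun}.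
Hypothesis Hdot : hilbert_norm dot.
Context {d} {S : measurableType d}.
Variable mu : probability S R.

Lemma finite_range_sum (f : S -> H) (h : H -> R) s : finite_set (range f) ->
  h (f s) = \sum_(v <- fset_set (range f)) h v * \1_(f @^-1` [set v]) s.
Proof.
move=> fr; rewrite (bigD1_seq (f s)) ?fset_uniq //=; last first.
  by rewrite in_fset_set // inE; exists s.
rewrite indicE mem_set //= mulr1 big1 ?addr0 // => v vs.
by rewrite indicE memNset ?mulr0 //= => /esym/eqP; rewrite (negbTE vs).
Qed.

Lemma integral_finite_range (f : S -> H) (y : H) : finite_set (range f) ->
  (forall v, measurable (f @^-1` [set v])) ->
  mu.-integrable setT (fun s => (dot (f s) y)%:E) /\
  (\int[mu]_s (dot (f s) y)%:E =
   (dot (\sum_(v \in range f) fine (mu (f @^-1` [set v])) *: v) y)%:E)%E.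
Proof.
move=> fr mf.
pose g v s : \bar R := ((dot v y)%:E * (\1_(f @^-1` [set v]) s)%:E)%E.
have gE s : (dot (f s) y)%:E = (\sum_(v <- fset_set (range f)) g v s)%E.
  by rewrite (finite_range_sum (fun v => dot v y) s fr) sumEFin.
have ig v : mu.-integrable setT (g v).
  apply: integrableZl => //; apply: (eq_integrable _ (EFin \o \1_(f @^-1` [set v]))) => //.
  exact: integrable_indic.
split.
  by apply: (eq_integrable _ _ _ (fun s _ => esym (gE s))) => //; exact: integrable_sum.
under eq_integral do rewrite gE.
rewrite integral_sum // fsbig_finite //= 
  (big_morph (fun v => dot v y) (fun a b => dotDl dot a b y) (linear0l dot y)) -sumEFin.
apply: eq_bigr => v _; rewrite dotZl integralZl //; last exact: integrable_indic.
by rewrite integral_indic // setIT -[X in (_ * X)%E]fineK ?fin_num_measure // -EFinM mulrC.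
Qed.

(** The identity is elementary for the finitely-valued approximants, and replacing X by [f n]
    changes the scalar integral by at most |y| times the L^1 distance. The factor |y| + 1 keeps the
    divisions meaningful for y = 0. *)
Lemma bochner_integral_dot (X : S -> H) (m y : H) : is_bochner_integral mu X m ->
  mu.-integrable setT (fun s => (dot (X s) y)%:E) ->
  (\int[mu]_s (dot (X s) y)%:E = (dot m y)%:E)%E.
Proof.
move=> [mX [f [fr mf fX fm]]] iX.
have fi n := integral_finite_range y (fr n) (mf n).
set B := fun n => \sum_(v \in range (f n)) fine (mu (f n @^-1` [set v])) *: v in fm.
have dotB : dot (B n) y @[n --> \oo] --> dot m y.
  apply/cvgrPdist_lt => e e0.
  have y0 : 0 < e / (`|y| + 1) by rewrite divr_gt0 ?ltr_wpDl.
  move/cvgrPdist_lt : fm => /(_ _ y0); apply: filterS => n.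
  rewrite ltr_pdivlMr ?ltr_wpDl // => h.
  rewrite -linearNl -linearDl (le_lt_trans (normr_dot_le Hdot _ _)) //.
  by apply: le_lt_trans h; rewrite ler_wpM2l // lerDl.
have y1 : 0 < `|y| + 1 by rewrite ltr_wpDl.
have dist n : (((`|y| + 1)^-1)%:E * `|\int[mu]_s (dot (X s) y)%:E - (dot (B n) y)%:E|
    <= \int[mu]_s (`|X s - f n s|)%:E)%E.
  have iB := integrableB measurableT iX (fi n).1.
  rewrite -(fi n).2 -integralB_EFin //; last exact: (fi n).1.
  have mB : measurable_fun setT (fun s => (dot (X s) y - dot (f n s) y)%:E).
    exact: measurable_int iB.
  apply: (@le_trans _ _ (((`|y| + 1)^-1)%:E *
      \int[mu]_s `|(dot (X s) y - dot (f n s) y)%:E|)%E).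
    by rewrite lee_pmul2l ?lte_fin ?invr_gt0 // le_abse_integral.
  have r0 : 0 <= (`|y| + 1)^-1 by rewrite invr_ge0 ltW.
  rewrite -ge0_integralZl //; last exact: measurableT_comp.
    apply: le_integralT => s; first by rewrite lee_fin mulr_ge0 ?invr_ge0 // ltW.
    rewrite -EFinM lee_fin ler_pdivrMl // -linearNl -linearDl.
    rewrite (le_trans (normr_dot_le Hdot _ _)) // mulrC ler_wpM2r //.
    by rewrite lerDl.
have fI : (\int[mu]_s (dot (X s) y)%:E)%E \is a fin_num by exact: integrable_fin_num.
move: dist; rewrite -(fineK fI); set I := fine _ => dist.
congr EFin; apply/esym; apply: (@cvg_unique _ (@norm_hausdorff _ R^o) _ _ _ _ dotB).
apply/cvgrPdist_le => e e0.
move/fine_cvgP : fX => [fXf /cvgrPdist_le fX].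
have e1 : 0 < e / (`|y| + 1) by rewrite divr_gt0.
have := fX _ e1; move: fXf; apply: filterS2 => n fn.
rewrite sub0r normrN ger0_norm ?fine_ge0 ?integral_ge0 // => h.
have := dist n; rewrite -EFinB /= -EFinM -(fineK fn) lee_fin ler_pdivrMl // => h'.
by apply: le_trans h' _; rewrite mulrC -ler_pdivlMr.
Qed.

End weak_mean.

(** * Almost sure values in a separable hull *)

Section support.
Context {R : realType} {H : completeNormedModType R}.
Context {d} {T : measurableType d}.

(** Exhausts the complement of the closed hull by sets at a fixed positive distance from it, to
    which Markov's inequality applies. *)
Definition far (c : nat -> H) (j : nat) : set H :=
  [set x | forall m, j.+1%:R^-1 <= `|x - c m|].

Lemma closure_seqE c : closure_seq c = ~` \bigcup_j far c j.
Proof.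
apply/seteqP; split => [x cx [j _ xj]|x xc e e0].
  have [|m] := cx (j.+1%:R^-1); first by rewrite invr_gt0.
  by rewrite ltNge xj.
apply: contrapT => /forallNP h; apply: xc; have [j je] := natSinv_lt e0.
exists j => // m; apply: (le_trans (ltW je)).
by rewrite leNgt; apply/negP; exact: h.
Qed.

Lemma far_measurable c j (D : set T) (X : T -> H) : measurable D ->
  measurable_fun D (X : T -> borel H) -> measurable (D `&` X @^-1` far c j).
Proof.
move=> mD mX.
have -> : D `&` X @^-1` far c j =
    \bigcap_m (D `&` (fun w => `|X w - c m|) @^-1` `[j.+1%:R^-1, +oo[).
  apply/seteqP; split => [w [Dw wj] m _|w wj].
    by split => //=; rewrite in_itv /= andbT wj.
  split; first by have [] := wj 0%N I.
  by move=> m; have [_] := wj m I; rewrite /= in_itv /= andbT.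
apply: bigcapT_measurable => m.
have := borel_lip (C := 1) (h := fun x => `|x - c m|) mX.
apply => //; move=> x y; rewrite mul1r (le_trans (ler_dist_dist _ _)) //.
by rewrite opprB addrA subrK.
Qed.

Lemma closure_seq_measurable c (D : set T) (X : T -> H) : measurable D ->
  measurable_fun D (X : T -> borel H) -> measurable (D `&` X @^-1` closure_seq c).
Proof.
move=> mD mX; 
have -> : D `&` X @^-1` closure_seq c = D `\` \bigcup_j (D `&` X @^-1` far c j).
  rewrite closure_seqE; apply/seteqP; split => w [Dw h]; split => //= -[j _ wj].
    by apply: h; exists j => //; case: wj.
  by apply: h; exists j.
apply: measurableD => //; apply: bigcupT_measurable => j; exact: far_measurable.
Qed.

Variable mu : {measure set T -> \bar R}.

Lemma not_closure_seq_null c (X : T -> H) :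
  measurable_fun setT (X : T -> borel H) -> (forall j, mu (X @^-1` far c j) = 0%E) ->
  mu (X @^-1` (~` closure_seq c)) = 0%E.
Proof.
move=> mX Xj.
have -> : X @^-1` (~` closure_seq c) = \bigcup_j (X @^-1` far c j).
  by rewrite closure_seqE setCK preimage_bigcup.
have mj j : measurable (X @^-1` far c j).
  by have := far_measurable c j measurableT mX; rewrite setTI.
have mU : measurable (\bigcup_j (X @^-1` far c j)) by exact: bigcupT_measurable.
apply/(negligibleP _ mU).
apply: (@negligible_bigcup _ _ _ mu (fun j => X @^-1` far c j)) => j.
by apply: (iffRL (negligibleP _ (mj j))); exact: Xj.
Qed.

Lemma null_of_small (N : set T) (a : R) (b : nat -> \bar R) : 0 < a ->
  (forall n, a%:E * mu N <= b n)%E -> b n @[n --> \oo] --> 0%E -> mu N = 0%E.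
Proof.
move=> a0 Nb b0; apply/eqP; rewrite eq_le measure_ge0 andbT.
suff : (a%:E * mu N <= 0)%E by rewrite pmule_rle0 ?lte_fin.
by apply: (cvge_to_ge b0); exact: nearW.
Qed.

End support.

Section noise_support.
Context {R : realType} {H : completeNormedModType R}.
Context {d} {S : measurableType d}.
Variable mu : probability S R.

(** The sequence [w] lists the values of all approximants. Where X is [far] from a hull containing
    them, |X - f n| is at least 1 / (j + 1) for every n, so the L^1 convergence makes that event
    null. *)
Lemma bochner_support (X : S -> H) (m : H) : is_bochner_integral mu X m ->
  exists w : nat -> H, forall c, (forall i, exists j, c j = w i) ->
    mu (X @^-1` (~` closure_seq c)) = 0%E.
Proof.
move=> [mX [f [fr mf fX fm]]].
have /choice[r rP] n : exists r : seq H, range (f n) = [set` r].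
  by have /finite_seqP := fr n.
exists (fun i => let p := odflt (0, 0)%N (choice.unpickle i) in nth 0 (r p.1) p.2).
move=> c cw; have fc n s : exists j, c j = f n s.
  have : (f n s) \in r n by have : range (f n) (f n s) by []; rewrite rP.
  move=> /(nthP 0)[i ir <-].
  by have := cw (choice.pickle (n, i)); rewrite choice.pickleK.
apply: not_closure_seq_null => // j.
apply: (@null_of_small _ _ _ mu _ j.+1%:R^-1 _ _ _ fX) => // n.
apply: markov_set => //.
  by have := far_measurable c j measurableT mX; rewrite setTI.
by move=> s sj; rewrite lee_fin; have [i <-] := fc n s; exact: sj.
Qed.

Variables (delta : S -> H -> H) (LDelta : R).
Hypothesis delta_meas : measurable_fun setT
     ((fun p => delta p.1 p.2) : S * borel H -> borel H).
Hypothesis delta_lip : forall x y,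
     (\int[mu]_s (`|delta s x - delta s y| ^+ 2)%:E
        <= (LDelta ^+ 2 * `|x - y| ^+ 2)%:E)%E.
Variable c : nat -> H.
Let K := closure_seq c.
Hypothesis delta_c : forall m, mu (delta ^~ (c m) @^-1` (~` K)) = 0%E.

Lemma delta_section x : measurable_fun setT (delta ^~ x : S -> borel H).
Proof.
apply: (measurableT_comp delta_meas (g := fun s => (s, x) : S * borel H)).
exact: measurable_fun_pair.
Qed.

(** Only countably many null events can be discarded, and those are spent on the points [c m]. For a
    limit point [x] the mean-square Lipschitz bound takes over: where the noise at [c m] lies in K
    but the noise at [x] is far from it, the two differ by at least 1 / (j + 1), while [c m] may be
    taken arbitrarily close to [x]. *)
Lemma delta_support x : K x -> mu (delta ^~ x @^-1` (~` K)) = 0%E.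
Proof.
move=> Kx; apply: not_closure_seq_null => [|j]; first exact: delta_section.
have mN : measurable (delta ^~ x @^-1` far c j).
  by have := far_measurable c j measurableT (delta_section x); rewrite setTI.
apply: (@null_of_small _ _ _ mu _ (j.+1%:R^-1 ^+ 2)
  (fun n => (LDelta ^+ 2 * n.+1%:R^-1)%:E)) => [|n|].
- by rewrite exprn_gt0 // invr_gt0.
- have n0 : 0 < n.+1%:R^-1 :> R by rewrite invr_gt0.
  have [m xm] := Kx _ n0.
  set M := delta ^~ (c m) @^-1` (~` K).
  have mM : measurable M.
    rewrite /M -preimage_setC; apply: measurableC.
    have := closure_seq_measurable c measurableT (delta_section (c m)).
    by rewrite setTI.
  have mNM : measurable (delta ^~ x @^-1` far c j `\` M) by exact: measurableD.
  apply: (@le_trans _ _ ((j.+1%:R^-1 ^+ 2)%:E * mu (delta ^~ x @^-1` far c j `\` M))%E).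
    rewrite lee_pmul2l ?lte_fin ?exprn_gt0 ?invr_gt0 //.
    apply: (@le_trans _ _ (mu ((delta ^~ x @^-1` far c j `\` M) `|` M))).
      apply: le_measure; rewrite ?inE //; first exact: measurableU.
      by move=> s sj; have [?|?] := pselect (M s); [right|left].
    have M0 : mu M = 0%E by exact: delta_c.
    rewrite (le_trans (measureU2 _ _ _)) // [X in (_ + X <= _)%E](_ : _ = 0%E) //.
    by rewrite adde0.
  apply: le_trans (le_trans (delta_lip x (c m)) _); last first.
    rewrite lee_fin ler_wpM2l ?sqr_ge0 // (le_trans _ (ltW xm)) //.
    rewrite expr2 ler_piMl // (le_trans (ltW xm)) // invf_le1 ?ler1n //.
  apply: markov_set => //.
  move=> s [sj /contrapT Ks]; rewrite lee_fin lerXn2r ?nnegrE ?invr_ge0 //.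
  rewrite leNgt; apply/negP => h.
  (* The noise at [c m] lies in K, so some [c i] is closer to it than the remaining gap; this puts
     the noise at [x] within 1 / (j + 1) of [c i], a contradiction. *)
  have /Ks[i] : 0 < j.+1%:R^-1 - `|delta s x - delta s (c m)| by rewrite subr_gt0.
  rewrite ltrBrDl => /(le_lt_trans (ler_normD _ _)).
  by rewrite addrA subrK ltNge sj.
- apply: cvg_EFin; first by apply: nearW.
  rewrite -(mulr0 (LDelta ^+ 2)); apply: cvgMl_tmp; exact: cvg_harmonic.
Qed.

End noise_support.

(** * Moments of the noise at points determined by the past *)

Section noise.
Context {R : realType} {H : completeNormedModType R}.
Variable dot : {dot H for idfun}.
Hypothesis Hdot : hilbert_norm dot.
Context {dO dS : measure_display}.
Context {Omega : measurableType dO} {S : measurableType dS}.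
Variables (mu : probability S R) (P : probability Omega R).
Variable xi : nat -> {mfun Omega >-> S}.
Hypothesis xi_law : forall i B, measurable B -> distribution P (xi i) B = mu B.
Hypothesis xi_indep : mutually_independent P xi.
Variables (delta : S -> H -> H) (sigma LDelta : R).
Hypothesis delta_meas : measurable_fun setT
     ((fun p => delta p.1 p.2) : S * borel H -> borel H).
Hypothesis delta_mean : forall z, is_bochner_integral mu (delta ^~ z) 0.
Hypothesis delta_var : forall z,
     (\int[mu]_s (`|delta s z| ^+ 2)%:E <= (sigma ^+ 2)%:E)%E.
Hypothesis delta_lip : forall x y,
     (\int[mu]_s (`|delta s x - delta s y| ^+ 2)%:E
        <= (LDelta ^+ 2 * `|x - y| ^+ 2)%:E)%E.
Variable c : nat -> H.
Let K := closure_seq c.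
Hypothesis K0 : K 0.
Hypothesis KD : forall x y, K x -> K y -> K (x + y).
Hypothesis KZ : forall a x, K x -> K (a *: x).
Hypothesis delta_K : forall x, K x -> mu (delta ^~ x @^-1` (~` K)) = 0%E.

Notation past k := (g_sigma_algebraType (past_generator P xi k)).

(** Composition with [delta] and Tonelli's theorem call for maps that are measurable on the whole
    space. The value 0 off [D] keeps the extension inside [K]. *)
Lemma meas_in_extend {d} {T : measurableType d} (D : set T) (X : T -> H) :
  measurable D -> meas_in c D X ->
  exists2 X', meas_in c setT X' & forall w, D w -> X' w = X w.
Proof.
move=> mD [mX XK]; exists (fun w => if mem D w then X w else 0); last first.
  by move=> w Dw; have -> : mem D w = true by exact/mem_set.
split; last by move=> w _; case: ifPn => // /set_mem; exact: XK.
apply: (measurable_fun_if (T2 := borel H)) => //.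
  by apply: (measurable_fun_bool true); rewrite setTI preimage_mem_true.
by rewrite setTI preimage_mem_true.
Qed.

Lemma sampled_measurable k (Z : past k -> H) : measurable_fun setT (Z : past k -> borel H) ->
  measurable_fun setT ((fun p => delta p.2 (Z p.1)) : past k * S -> borel H).
Proof.
move=> mZ.
apply: (measurableT_comp delta_meas (g := fun p : past k * S => (p.2, Z p.1) : S * borel H)).
apply: measurable_fun_pair; first exact: measurable_snd.
by apply: (measurableT_comp mZ); exact: measurable_fst.
Qed.

Lemma past_pair_measurable k :
  measurable_fun setT ((fun w => (w, xi k w)) : past k.+1 -> past k * S).
Proof.
apply: measurable_fun_pair; last exact: past_xi.
by move=> _ A mA; rewrite setTI; exact: past_mono.
Qed.

Lemma sampled_past k (Z : past k -> H) : measurable_fun setT (Z : past k -> borel H) ->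
  measurable_fun setT ((fun w => delta (xi k w) (Z w)) : past k.+1 -> borel H).
Proof.
move=> mZ; have mf := sampled_measurable mZ.
exact: (measurableT_comp mf (@past_pair_measurable k)).
Qed.

Lemma sampled_meas_in k (D : set Omega) (Z : Omega -> H) :
  measurable (D : set (past k)) -> meas_in c (D : set (past k)) Z ->
  let D' := D `&` [set w | K (delta (xi k w) (Z w))] in
  [/\ measurable (D' : set (past k.+1)), P (D `\` D') = 0%E &
      meas_in c (D' : set (past k.+1)) (fun w => delta (xi k w) (Z w))].
Proof.
move=> mD /(meas_in_extend mD)[Z' [mZ' Z'K] Z'Z] D'.
have D'E : D' = D `&` [set w | K (delta (xi k w) (Z' w))].
  by apply/seteqP; split => w [Dw]; rewrite /= Z'Z.
have mX := sampled_past mZ'.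
have mD1 : measurable (D : set (past k.+1)) by exact: past_mono.
have mD' : measurable (D' : set (past k.+1)).
  by rewrite D'E; exact: (closure_seq_measurable c mD1 (measurable_funTS mX)).
split => //; last first.
  apply: (@meas_in_eq _ _ _ _ (past k.+1) D' (fun w => delta (xi k w) (Z' w))).
    by move=> w [Dw _]; rewrite Z'Z.
  by split; [exact: measurable_funTS mX|rewrite D'E => w []].
pose B := (fun p : past k * S => delta p.2 (Z' p.1)) @^-1` (~` K).
have mB : measurable B.
  rewrite /B -preimage_setC; apply: measurableC.
  have := closure_seq_measurable c measurableT (sampled_measurable mZ').
  by rewrite setTI.
have mDD' : measurable (D `\` D' : set Omega).
  by apply: measurableD; [exact: past_sub mD|exact: past_sub mD'].
apply/eqP; rewrite eq_le measure_ge0 andbT.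
apply: (@le_trans _ _ (\int[P]_w (\1_B (w, xi k w))%:E)%E).
  rewrite -[X in (X <= _)%E]mul1e; apply: markov_set => //.
  move=> w [Dw]; rewrite D'E => /not_andP[//|nK].
  by rewrite indicE mem_set.
rewrite (@past_tonelli _ _ _ _ _ _ _ _ xi_law xi_indep k (fun p => (\1_B p)%:E)) //; last first.
  by apply/measurable_EFinP; exact: measurable_indic.
rewrite integral0_eq // => w _.
rewrite -(delta_K (Z'K w I)).
rewrite -(setIT (delta ^~ (Z' w) @^-1` (~` K))) -integral_indic //.
rewrite -preimage_setC; apply: measurableC.
have := closure_seq_measurable c measurableT (delta_section delta_meas (Z' w)).
by rewrite setTI.
Qed.

Definition sampled_domain k (D : set Omega) (Z : Omega -> H) : set (past k * S) :=
  [set p | D p.1 /\ K (delta p.2 (Z p.1))].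

Lemma sampled_meas_in_pair k (D : set Omega) (Z : Omega -> H) :
  measurable (D : set (past k)) -> meas_in c (D : set (past k)) Z ->
  measurable (@sampled_domain k D Z) /\
  meas_in c (@sampled_domain k D Z) (fun p => delta p.2 (Z p.1)).
Proof.
move=> mD /(meas_in_extend mD)[Z' [mZ' Z'K] Z'Z].
have mX := sampled_measurable mZ'.
have mD1 : measurable ((fst : past k * S -> past k) @^-1` D).
  by rewrite -[X in measurable X]setTI; exact: measurable_fst.
have GE : @sampled_domain k D Z =
    (fst : past k * S -> past k) @^-1` D `&` (fun p => delta p.2 (Z' p.1)) @^-1` K.
  by apply/seteqP; split => p [Dp]; rewrite /= Z'Z.
have mG : measurable (@sampled_domain k D Z).
  by rewrite GE; exact: (closure_seq_measurable c mD1 (measurable_funTS mX)).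
split => //.
apply: (@meas_in_eq _ _ _ _ (past k * S)%type _ (fun p => delta p.2 (Z' p.1))).
  by move=> p [Dp _]; rewrite Z'Z.
by split; [exact: measurable_funTS mX|rewrite GE => p []].
Qed.

Lemma sampled_tonelli k (D : set Omega) (G : set (past k * S)) (f : past k * S -> R) :
  measurable G -> measurable_fun G f -> (forall p, G p -> 0 <= f p) ->
  (forall w, D w <-> G (w, xi k w)) ->
  (\int[P]_(w in D) (f (w, xi k w))%:E =
   \int[P]_w \int[mu]_(s in [set s | G (w, s)]) (f (w, s))%:E)%E.
Proof.
move=> mG mf f0 DG.
rewrite integral_mkcond.
transitivity (\int[P]_w ((EFin \o f) \_ G) (w, xi k w))%E.
  apply: eq_integral => w _; rewrite !patchE /=.
  by congr (if _ then _ else _); apply/idP/idP => /set_mem h; apply/mem_set; exact/DG.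
rewrite (@past_tonelli _ _ _ _ _ _ _ _ xi_law xi_indep k ((EFin \o f) \_ G)).
- apply: eq_integral => w _; rewrite [RHS]integral_mkcond.
  apply: eq_integral => s _; rewrite !patchE /=.
  by congr (if _ then _ else _); apply/idP/idP => /set_mem h; apply/mem_set.
- have mEf : measurable_fun G (EFin \o f) by exact/measurable_EFinP.
  exact: (measurable_restrictT _ mG).1 mEf.
- by move=> p; rewrite patchE; case: ifPn => // /set_mem Gp; rewrite lee_fin f0.
Qed.

Lemma ge0_integral_set_le {d} {T : measurableType d} (m : {measure set T -> \bar R})
    (D : set T) (f g : T -> R) :
  (forall x, D x -> 0 <= f x) -> (forall x, 0 <= g x) ->
  (forall x, D x -> f x <= g x) ->
  (\int[m]_(x in D) (f x)%:E <= \int[m]_x (g x)%:E)%E.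
Proof.
move=> f0 g0 fg; rewrite integral_mkcond; apply: le_integralT => x;
  by rewrite patchE; case: ifPn => [/set_mem Dx|_]; rewrite lee_fin ?f0 ?fg.
Qed.

Lemma noise_second_moment k (D : set Omega) (Z : Omega -> H) :
  measurable (D : set (past k)) -> meas_in c (D : set (past k)) Z ->
  (forall w, D w -> K (delta (xi k w) (Z w))) ->
  (\int[P]_(w in D) (`|delta (xi k w) (Z w)| ^+ 2)%:E <= (sigma ^+ 2)%:E)%E.
Proof.
move=> mD mZ DK; have [mG mX] := sampled_meas_in_pair mD mZ.
rewrite (@sampled_tonelli k D _ (fun p => `|delta p.2 (Z p.1)| ^+ 2) mG).
- apply: (@le_trans _ _ (\int[P]_w (sigma ^+ 2)%:E)%E); last first.
    rewrite integral_cst // [X in (_ * X <= _)%E](_ : _ = 1%E) ?mule1 //.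
    exact: probability_setT.
  apply: le_integralT => w; first by apply: integral_ge0 => s _; rewrite lee_fin exprn_ge0.
  by apply: le_trans (delta_var (Z w)); apply: ge0_integral_set_le => s; rewrite ?exprn_ge0.
- by apply: measurable_funX; exact: meas_in_norm mX.
- by move=> p _; rewrite exprn_ge0.
- by move=> w; split => [Dw|[]//]; split => //; exact: DK.
Qed.

Lemma noise_increment_moment k (D : set Omega) (Z1 Z2 : Omega -> H) :
  measurable (D : set (past k)) -> meas_in c (D : set (past k)) Z1 ->
  meas_in c (D : set (past k)) Z2 ->
  (forall w, D w -> K (delta (xi k w) (Z1 w))) ->
  (forall w, D w -> K (delta (xi k w) (Z2 w))) ->
  (\int[P]_(w in D) (`|delta (xi k w) (Z1 w) - delta (xi k w) (Z2 w)| ^+ 2)%:E <=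
   \int[P]_(w in D) (LDelta ^+ 2 * `|Z1 w - Z2 w| ^+ 2)%:E)%E.
Proof.
move=> mD mZ1 mZ2 DK1 DK2; have [mG1 mX1] := sampled_meas_in_pair mD mZ1.
have [mG2 mX2] := sampled_meas_in_pair mD mZ2.
set G1 := sampled_domain _ _ in mG1 mX1; set G2 := sampled_domain _ _ in mG2 mX2.
have mG := measurableI _ _ mG1 mG2.
rewrite (@sampled_tonelli k D (G1 `&` G2)
  (fun p => `|delta p.2 (Z1 p.1) - delta p.2 (Z2 p.1)| ^+ 2) mG).
- rewrite [leRHS]integral_mkcond; apply: le_integralT => w.
    by apply: integral_ge0 => s _; rewrite lee_fin exprn_ge0.
  rewrite patchE; case: ifPn => [/set_mem Dw|/negP Dw] /=.
    apply: le_trans (delta_lip _ _).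
    by apply: ge0_integral_set_le => s; rewrite ?exprn_ge0.
  by rewrite integral0_eq // => s [[/mem_set]].
- apply: measurable_funX; apply: (meas_in_norm (c := c) mG).
  by apply: (meas_inB KD KZ mG); [apply: meas_inS mX1|apply: meas_inS mX2].
- by move=> p _; rewrite exprn_ge0.
- by move=> w; split => [Dw|[[]]//]; split; split => //; [exact: DK1|exact: DK2].
Qed.

Lemma noise_dot_integrable x y : mu.-integrable setT (fun s => (dot (delta s x) y)%:E).
Proof.
have mX := delta_section delta_meas x.
apply: (@le_integrable _ _ _ mu _ measurableT _
  (fun s => (`|y| + `|y| * `|delta s x| ^+ 2)%:E)).
- apply/measurable_EFinP; apply: (borel_lip (C := `|y|) (h := dot ^~ y) mX) => a b.
  by rewrite -linearNl -linearDl (le_trans (normr_dot_le Hdot _ _)) // mulrC.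
- move=> s _; rewrite lee_fin (le_trans (normr_dot_le Hdot _ _)) //.
  rewrite ger0_norm ?addr_ge0 ?mulr_ge0 ?exprn_ge0 // mulrC.
  rewrite -[X in X + _]mulr1 -mulrDr ler_wpM2l //.
  have := sqr_ge0 (`|delta s x| - 1); nra.
- apply: (@integrableD _ _ _ mu _ measurableT (cst `|y|%:E) (fun s => (`|y| * `|delta s x| ^+ 2)%:E)).
    exact: finite_measure_integrable_cst.
  under eq_fun do rewrite EFinM; apply: integrableZl => //.
  apply/integrableP; split.
    apply/measurable_EFinP; apply: measurable_funX.
    apply: (borel_lip (C := 1) (h := fun a => `|a|) mX) => a b.
    by rewrite mul1r ler_dist_dist.
  under eq_integral do rewrite gee0_abs ?lee_fin ?exprn_ge0 //.
  by rewrite (le_lt_trans (delta_var x)) // ltry.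
Qed.

Lemma integral_eq0_parts {d} {T : measurableType d} (m : {measure set T -> \bar R})
    (D : set T) (f : T -> R) : measurable D -> m.-integrable D (EFin \o f) ->
  (\int[m]_(x in D) (f x)%:E = 0)%E <->
  (\int[m]_(x in D) (f^\+ x)%:E = \int[m]_(x in D) (f^\- x)%:E)%E.
Proof.
move=> mD fi; rewrite integralE.
have -> : (fun x => (f x)%:E) = EFin \o f by [].
rewrite funerpos funerneg.
have fn : (\int[m]_(x in D) (f^\- x)%:E)%E \is a fin_num.
  by have := integrable_neg_fin_num mD fi; rewrite funerneg.
have fp : (\int[m]_(x in D) (f^\+ x)%:E)%E \is a fin_num.
  by have := integrable_pos_fin_num mD fi; rewrite funerpos.
rewrite -[X in (X - _)%E]/(\int[m]_(x in D) (f^\+ x)%:E)%E.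
rewrite -[X in (_ - X)%E]/(\int[m]_(x in D) (f^\- x)%:E)%E.
move: (integral _ _ _) fp (integral _ _ _) fn => a fa b fb.
split => [/eqP|->]; last exact: subee.
by rewrite sube_eq ?add0e ?fin_num_adde_defl // => /eqP.
Qed.

Lemma noise_dot_mean k (D : set Omega) (Z Y : Omega -> H) :
  measurable (D : set (past k)) -> meas_in c (D : set (past k)) Z ->
  meas_in c (D : set (past k)) Y ->
  (forall w, D w -> K (delta (xi k w) (Z w))) ->
  P.-integrable D (fun w => (dot (delta (xi k w) (Z w)) (Y w))%:E) ->
  (\int[P]_(w in D) (dot (delta (xi k w) (Z w)) (Y w))%:E = 0)%E.
Proof.
move=> mD mZ mY DK iD; have [mG mX] := sampled_meas_in_pair mD mZ.
set G := sampled_domain _ _ in mG mX.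
pose f (p : past k * S) := dot (delta p.2 (Z p.1)) (Y p.1).
have mf : measurable_fun G f.
  apply: (meas_in_dot KD KZ Hdot mG mX).
  have mD1 : measurable ((fst : past k * S -> past k) @^-1` D).
    by rewrite -[X in measurable X]setTI; exact: measurable_fst.
  apply: (@meas_inS _ _ _ _ (past k * S)%type _ _ _ mD1 _
    (meas_in_comp measurable_fst mD mY)).
  by move=> p [].
have DG w : D w <-> G (w, xi k w) by split => [Dw|[]//]; split => //; exact: DK.
have mDO : measurable (D : set Omega) by exact: past_sub mD.
apply/(integral_eq0_parts mDO iD).
rewrite -[LHS]/(\int[P]_(w in D) (f^\+ (w, xi k w))%:E)%E.
rewrite -[RHS]/(\int[P]_(w in D) (f^\- (w, xi k w))%:E)%E.
have tonelliP := sampled_tonelli mG (measurable_funrpos mf)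
  (fun p _ => funrpos_ge0 f p) DG.
have tonelliN := sampled_tonelli mG (measurable_funrneg mf)
  (fun p _ => funrneg_ge0 f p) DG.
apply: etrans tonelliP (etrans _ (esym tonelliN)).
apply: eq_integral => w _.
have [Dw|Dw] := pselect (D w); last first.
  by rewrite !integral0_eq // => s [].
have mGw : measurable [set s | G (w, s)] by have := measurable_xsection (w : past k) mG; rewrite xsectionE.
(* The section of [G] has full measure, so the inner integrals may be taken over all of [S], where
   the mean of the noise is known. *)
have muGw : mu (~` [set s | G (w, s)]) = 0%E.
  have -> : ~` [set s | G (w, s)] = delta ^~ (Z w) @^-1` (~` K).
    by apply/seteqP; split => s /= h; [move=> Ks; apply: h|case].
  by apply: delta_K; exact: mZ.2.
have fS (g : S -> R) : measurable_fun setT g -> (forall s, 0 <= g s) ->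
    (\int[mu]_(s in [set s | G (w, s)]) (g s)%:E = \int[mu]_s (g s)%:E)%E.
  move=> mg g0; rewrite [RHS](ge0_negligible_integral (measurableC mGw)) //.
  - by rewrite setTD setCK.
  - exact/measurable_EFinP.
  - by move=> s _; rewrite lee_fin.
have fi := noise_dot_integrable (Z w) (Y w).
have mfw : measurable_fun setT (fun s => f (w, s)).
  by apply/measurable_EFinP; exact: measurable_int fi.
rewrite (fS (fun s => f^\+ (w, s))) //; last exact: (measurable_funrpos mfw).
rewrite (fS (fun s => f^\- (w, s))) //; last exact: (measurable_funrneg mfw).
apply/(integral_eq0_parts measurableT fi).
rewrite (bochner_integral_dot Hdot (delta_mean (Z w))) //.
by rewrite linear0l.
Qed.

End noise.

(** * Measurability of the iterates *)

Lemma resolvent_nonexpansive {R : realType} {H : completeNormedModType R}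
    (dot : {dot H for idfun}) (a : R) (A : H -> set H) (x x' y y' : H) :
  hilbert_norm dot -> monotone_op dot A -> 0 <= a ->
  resolvent a A x y -> resolvent a A x' y' -> `|y - y'| <= `|x - x'|.
Proof.
move=> Hdot Amono a0 [u Ayu <-] [u' Ayu' <-].
rewrite -ler_sqr ?nnegrE // -!Hdot.
have -> : y + a *: u - (y' + a *: u') = (y - y') + a *: (u - u').
  by rewrite scalerBr opprD addrACA.
have := mulr_ge0 a0 (Amono _ _ _ _ Ayu Ayu').
have := dot_ge0 dot (a *: (u - u')).
move: (y - y') (u - u') => d e; rewrite dotDl !dotDr !dotZl !dotZr (dotC dot d e).
by move=> *; lra.
Qed.

Section adapted.
Context {R : realType} {H : completeNormedModType R}.
Context {dO dS : measure_display}.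
Context {Omega : measurableType dO} {S : measurableType dS}.
Variables (mu : probability S R) (P : probability Omega R).
Variable xi : nat -> {mfun Omega >-> S}.
Hypothesis xi_law : forall i B, measurable B -> distribution P (xi i) B = mu B.
Hypothesis xi_indep : mutually_independent P xi.
Variable delta : S -> H -> H.
Hypothesis delta_meas : measurable_fun setT
     ((fun p => delta p.1 p.2) : S * borel H -> borel H).
Variable c : nat -> H.
Let K := closure_seq c.
Hypothesis KD : forall x y, K x -> K y -> K (x + y).
Hypothesis KZ : forall a x, K x -> K (a *: x).
Hypothesis delta_K : forall x, K x -> mu (delta ^~ x @^-1` (~` K)) = 0%E.
Variables (L : R) (F : H -> H) (Lb : R) (A : H -> set H) (z0 : H).
Hypothesis F_lip : L.-lipschitz F.
Hypothesis KF : forall x, K x -> K (F x).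
Hypothesis Kz0 : K z0.
Hypothesis resolvent_lip : forall k x x' y y', resolvent (alpha Lb k) A x y ->
  resolvent (alpha Lb k) A x' y' -> `|y - y'| <= `|x - x'|.
Hypothesis resolventK : forall k x y, K x -> resolvent (alpha Lb k) A x y -> K y.
Variables z v : nat -> Omega -> H.
Hypothesis zv : is_vraf Lb F A z0 delta (fun i => xi i) z v.

Notation past k := (g_sigma_algebraType (past_generator P xi k)).

(** The sample [xi k'] is evaluated at [z k'] and, in the update of [v k'], at the preceding
    iterate. For k' = 0 the predecessor is again 0 and the last condition repeats the previous
    one. *)
Fixpoint regular k : set Omega :=
  if k is k'.+1 then
    regular k' `&` [set w | K (delta (xi k' w) (z k' w))]
               `&` [set w | K (delta (xi k' w) (z k'.-1 w))]
  else setT.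

Lemma meas_in_F {d} {T : measurableType d} (D : set T) (X : T -> H) :
  measurable D -> meas_in c D X -> meas_in c D (fun w => F (X w)).
Proof.
move=> mD mX; apply: (meas_in_lip (C := `|L|) _ mD mX) => //.
  by move=> w Dw; apply: KF; exact: mX.2.
move=> w w' _ _; have /= := @F_lip (X w, X w') (conj I I).
by move/le_trans; apply; rewrite ler_wpM2r // ler_norm.
Qed.

Lemma meas_in_past k (D : set Omega) (X : Omega -> H) :
  measurable (D : set (past k)) ->
  meas_in c (D : set (past k)) X -> meas_in c (D : set (past k.+1)) X.
Proof.
by move=> mD [mX XK]; split => // _ B mB; exact: past_mono (mX mD B mB).
Qed.

(** [z k] and [v k.-1] depend only on samples of index below [k]. The guard on [k] is needed because
    for k = 0 the predecessor would name [v 0], which involves [xi 0]. The new iterate inherits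
    measurability from nonexpansiveness of the resolvent, which makes it a Lipschitz function of the
    point being resolved. *)
Lemma adapted_regular k :
  [/\ measurable (regular k : set (past k)), P (~` regular k) = 0%E,
      meas_in c (regular k : set (past k)) (z k),
      meas_in c (regular k : set (past k)) (z k.-1) &
      (0 < k)%N -> meas_in c (regular k : set (past k)) (v k.-1)].
Proof.
have K0 : K 0 by rewrite -(scale0r z0); exact: KZ.
elim: k => [|k [mD PD mz mz1 mv]] /=.
  have mz0 : meas_in c (setT : set (past 0)) (z 0).
    apply: (@meas_in_eq _ _ _ _ (past 0) _ (fun=> z0)); last exact: meas_in_cst.
    by move=> w _; have [->] := zv w.
  by split => //; rewrite setCT measure0.
pose D1 := regular k `&` [set w | K (delta (xi k w) (z k w))].
pose D2 := regular k `&` [set w | K (delta (xi k w) (z k.-1 w))].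
have [mD1 PD1 md1] := sampled_meas_in xi_law xi_indep delta_meas K0 delta_K mD mz.
have [mD2 PD2 md2] := sampled_meas_in xi_law xi_indep delta_meas K0 delta_K mD mz1.
have mDk := past_mono mD.
have DE : regular k.+1 = D1 `&` D2.
  by apply/seteqP; split => w; [move=> [[? ?] ?]|move=> [[? ?] [_ ?]]].
have mD' : measurable (regular k.+1 : set (past k.+1)).
  by rewrite DE; exact: measurableI.
have sub0 : regular k.+1 `<=` regular k by move=> w [[]].
have sub1 : regular k.+1 `<=` D1 by rewrite DE; exact: subIsetl.
have sub2 : regular k.+1 `<=` D2 by rewrite DE; exact: subIsetr.
have mzk : meas_in c (regular k.+1 : set (past k.+1)) (z k).
  by apply: meas_inS (meas_in_past mD mz).
have mzk1 : meas_in c (regular k.+1 : set (past k.+1)) (z k.-1).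
  by apply: meas_inS (meas_in_past mD mz1).
have {}md1 : meas_in c (regular k.+1 : set (past k.+1)) (fun w => delta (xi k w) (z k w)).
  exact: meas_inS md1.
have {}md2 : meas_in c (regular k.+1 : set (past k.+1)) (fun w => delta (xi k w) (z k.-1 w)).
  exact: meas_inS md2.
have mvk : meas_in c (regular k.+1 : set (past k.+1)) (v k).
  have [k0|k0] := posnP k.
    apply: (@meas_in_eq _ _ _ _ (past k.+1) _ (fun w => F (z k w) + delta (xi k w) (z k w))).
      by move=> w _; rewrite k0; have [-> -> _ _] := zv w.
    by apply: meas_inD => //; exact: meas_in_F.
  have {}mv : meas_in c (regular k.+1 : set (past k.+1)) (v k.-1).
    by apply: meas_inS (meas_in_past mD (mv k0)).
  apply: (@meas_in_eq _ _ _ _ (past k.+1) _ (fun w =>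
      F (z k w) + delta (xi k w) (z k w) + (1 - gamma_next k.-1) *:
      (v k.-1 w - (F (z k.-1 w) + delta (xi k w) (z k.-1 w))))).
    by move=> w _; have [_ _ _ /(_ k.-1)] := zv w; rewrite (prednK k0) => ->.
  apply: meas_inD => //; first by apply: meas_inD => //; exact: meas_in_F.
  apply: meas_inZ => //; apply: meas_inB => //.
  by apply: meas_inD => //; exact: meas_in_F.
split => //.
- have mO (B : set Omega) i : measurable (B : set (past i)) -> measurable (B : set Omega).
    exact: past_sub.
  have mk := mO _ _ mD; have mk1 := mO _ _ mD1; have mk2 := mO _ _ mD2.
  apply/(negligibleP _ (measurableC (mO _ _ mD'))).
  apply: (@negligibleS _ _ _ P (~` regular k `|` (regular k `\` D1 `|` regular k `\` D2))).
    move=> w; rewrite DE => /not_andP nw; have [Dw|] := pselect (regular k w); last by left.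
    by right; case: nw; [left|right].
  apply: negligibleU; first exact/(negligibleP _ (measurableC mk)).
  apply: negligibleU.
    exact/(negligibleP _ (measurableD mk mk1)).
  exact/(negligibleP _ (measurableD mk mk2)).
pose x w := (1 - beta k) *: z k w + beta k *: z0 - alpha Lb k *: v k w.
have mx : meas_in c (regular k.+1 : set (past k.+1)) x.
  apply: meas_inB => //; last exact: meas_inZ.
  by apply: meas_inD => //; first exact: meas_inZ; apply: meas_in_cst; exact: KZ.
have zx w : resolvent (alpha Lb k) A (x w) (z k.+1 w) by have [_ _ + _] := zv w; apply.
apply: (meas_in_lip (C := 1) _ mD' mx) => //.
  by move=> w Dw; apply: resolventK (zx w); exact: mx.2.
by move=> w w' _ _; rewrite mul1r; exact: resolvent_lip (zx w) (zx w').
Qed.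

Lemma adapted : exists D : set Omega,
  [/\ forall k, measurable (D : set (past k)), P (~` D) = 0%E,
      forall k, meas_in c (D : set (past k)) (z k),
      forall k, meas_in c (D : set (past k.+1)) (v k) &
      forall k w, D w -> K (delta (xi k w) (z k w)) /\ K (delta (xi k w) (z k.-1 w))].
Proof.
pose D := \bigcap_k regular k.
have Dk k : D `<=` regular k by move=> w /(_ k I).
have mr k : measurable (regular k : set Omega).
  by have [mD _ _ _ _] := adapted_regular k; exact: past_sub mD.
have mD : measurable (D : set Omega) by exact: bigcapT_measurable.
have PD : P (~` D) = 0%E.
  apply/(negligibleP _ (measurableC mD)); rewrite setC_bigcap.
  apply: (@negligible_bigcup _ _ _ P (fun k => ~` regular k)) => k.
  apply: (iffRL (negligibleP _ (measurableC (mr k)))).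
  by have [_ PDk _ _ _] := adapted_regular k.
exists D; split => // [k|k|k|k w Dw].
- rewrite -[D]setCK; apply: measurableC.
  by apply: past_null => //; exact: measurableC.
- have [mDk _ mz _ _] := adapted_regular k; exact: meas_inS mz.
- have [mDk _ _ _ mv] := adapted_regular k.+1; exact: meas_inS (mv isT).
- by have [[_ ?] ?] := Dk k.+1 _ Dw.
Qed.

End adapted.

(** * Square-integrable random vectors *)

Section sqint_inegrable.
Context {R : realType} {H : completeNormedModType R}.
Variable dot : {dot H for idfun}.
Hypothesis Hdot : hilbert_norm dot.
Context {d} {T : measurableType d}.
Variable P : probability T R.
Variable c : nat -> H.
Let K := closure_seq c.
Hypothesis KD : forall x y, K x -> K y -> K (x + y).
Hypothesis KZ : forall a x, K x -> K (a *: x).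
Variable D : set T.
Hypothesis mD : measurable D.

(** Integrals are restricted to the event [D] of full measure, on which the whole trajectory stays
    in [K]; off it, sums of iterates may fail to be measurable. *)
Definition int_in (f : T -> R) := P.-integrable D (EFin \o f).

Definition mean_in (f : T -> R) : R := (\int[P]_(w in D) f w)%R.

Definition sqint_in (X : T -> H) :=
  meas_in c D X /\ int_in (fun w => dot (X w) (X w)).

Lemma int_in_le (f g : T -> R) : measurable_fun D f -> int_in g ->
  (forall w, D w -> `|f w| <= g w) -> int_in f.
Proof.
move=> mf gi fg; apply: (le_integrable mD _ _ gi); first exact/measurable_EFinP.
by move=> w Dw; rewrite /= lee_fin (le_trans (fg _ Dw)) // ler_norm.
Qed.

Lemma int_inD f g : int_in f -> int_in g -> int_in (fun w => f w + g w).
Proof. by move=> fi gi; exact: (integrableD mD fi gi). Qed.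

Lemma int_inZ a f : int_in f -> int_in (fun w => a * f w).
Proof. by move=> fi; exact: (integrableZl mD a fi). Qed.

Lemma int_inN f : int_in f -> int_in (fun w => - f w).
Proof. by move=> fi; under eq_fun do rewrite -mulN1r; exact: int_inZ. Qed.

Lemma int_inB f g : int_in f -> int_in g -> int_in (fun w => f w - g w).
Proof. by move=> fi gi; exact/int_inD/int_inN. Qed.

Lemma int_in_cst a : int_in (fun=> a).
Proof.
apply: (integrableS measurableT mD) => //.
exact: finite_measure_integrable_cst.
Qed.

Lemma mean_inD f g : int_in f -> int_in g ->
  mean_in (fun w => f w + g w) = mean_in f + mean_in g.
Proof. by move=> fi gi; rewrite /mean_in RintegralD. Qed.

Lemma mean_inZ a f : int_in f -> mean_in (fun w => a * f w) = a * mean_in f.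
Proof. by move=> fi; rewrite /mean_in RintegralZl. Qed.

Lemma mean_inN f : int_in f -> mean_in (fun w => - f w) = - mean_in f.
Proof.
move=> fi; have -> : (fun w => - f w) = (fun w => -1 * f w).
  by apply/funext => w; rewrite mulN1r.
by rewrite mean_inZ // mulN1r.
Qed.

Lemma mean_inB f g : int_in f -> int_in g ->
  mean_in (fun w => f w - g w) = mean_in f - mean_in g.
Proof. by move=> fi gi; rewrite mean_inD ?mean_inN //; exact: int_inN. Qed.

Lemma mean_in_le f g : int_in f -> int_in g -> (forall w, D w -> f w <= g w) ->
  mean_in f <= mean_in g.
Proof. by move=> fi gi fg; exact: le_Rintegral. Qed.

Lemma mean_in_ge0 f : (forall w, D w -> 0 <= f w) -> 0 <= mean_in f.
Proof. by move=> f0; exact: Rintegral_ge0. Qed.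

Lemma mean_in_cst_le a : 0 <= a -> mean_in (fun=> a) <= a.
Proof.
move=> a0; rewrite /mean_in Rintegral_cst // ler_piMr // -lee_fin fineK ?fin_num_measure //.
exact: probability_le1.
Qed.

Lemma mean_in_eq f g : (forall w, D w -> f w = g w) -> mean_in f = mean_in g.
Proof. by move=> fg; apply: eq_Rintegral => w /set_mem /fg. Qed.

Lemma int_in_eq f g : (forall w, D w -> f w = g w) -> int_in f -> int_in g.
Proof.
by move=> fg; apply: eq_integrable => // w /set_mem /fg /= ->.
Qed.

Lemma sqint_in_dot X Y : sqint_in X -> sqint_in Y ->
  int_in (fun w => dot (X w) (Y w)).
Proof.
move=> [mX iX] [mY iY].
apply: (int_in_le _ (int_inD iX iY)); first exact: (meas_in_dot KD KZ Hdot).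
move=> w _.
have h1 := dot_ge0 dot (X w + Y w); have h2 := dot_ge0 dot (X w - Y w).
move: h1 h2 (dot_ge0 dot (X w)) (dot_ge0 dot (Y w)); rewrite !dotE (dotC dot (Y w) (X w)).
by move=> *; rewrite ler_norml; apply/andP; split; lra.
Qed.

Lemma sqint_in_bound X Z a : sqint_in X -> meas_in c D Z ->
  (forall w, D w -> `|Z w| <= `|X w| + a) -> sqint_in Z.
Proof.
move=> [mX iX] mZ ZX; split => //.
apply: (int_in_le (g := fun w => 2 * dot (X w) (X w) + 2 * a ^+ 2)).
- exact: (meas_in_dot KD KZ Hdot).
- by apply: int_inD; [exact: int_inZ|exact: int_in_cst].
- move=> w Dw; rewrite ger0_norm ?dot_ge0 // !Hdot.
  have := ZX _ Dw; have : 0 <= `|Z w| by [].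
  have := sqr_ge0 (`|X w| - a); move: `|Z w| `|X w| => s t *; nra.
Qed.

Lemma sqint_in_eq X Y : (forall w, D w -> X w = Y w) -> sqint_in X -> sqint_in Y.
Proof.
move=> XY [mX iX]; split; first exact: meas_in_eq mX.
by apply: int_in_eq iX => w /XY ->.
Qed.

Lemma sqint_in_cst x : K x -> sqint_in (fun=> x).
Proof. by move=> Kx; split; [exact: meas_in_cst|exact: int_in_cst]. Qed.

Lemma sqint_inZ a X : sqint_in X -> sqint_in (fun w => a *: X w).
Proof.
move=> [mX iX]; split; first exact: meas_inZ.
by apply: int_in_eq (int_inZ (a ^+ 2) iX) => w _; rewrite !dotE; ring.
Qed.

Lemma sqint_inD X Y : sqint_in X -> sqint_in Y -> sqint_in (fun w => X w + Y w).
Proof.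
move=> sX sY; split; first by apply: meas_inD => //; [exact: sX.1|exact: sY.1].
apply: int_in_eq (int_inD (int_inD sX.2 (int_inZ 2 (sqint_in_dot sX sY))) sY.2) => w _.
by rewrite !dotE (dotC dot (Y w)); ring.
Qed.

Lemma sqint_inB X Y : sqint_in X -> sqint_in Y -> sqint_in (fun w => X w - Y w).
Proof.
move=> sX sY; apply: sqint_in_eq (sqint_inD sX (sqint_inZ (-1) sY)) => w _.
by rewrite scaleN1r.
Qed.

End sqint_inegrable.

(** * Trajectories *)

Section trajectory.
Context {R : realType} {H : completeNormedModType R}.
Variable dot : {dot H for idfun}.
Hypothesis Hdot : hilbert_norm dot.

(* Turns identities in [H] into scalar ones, within reach of [ring], [field]. *)
Lemma dot_inj x y : (forall t, dot x t = dot y t) -> x = y.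
Proof.
move=> xy; apply/eqP; rewrite -subr_eq0 -normr_eq0 -sqrf_eq0 -Hdot.
by rewrite dotDl dotNl xy subrr.
Qed.

Variables (L Lb : R) (F : H -> H) (A : H -> set H) (z0 zstar : H).
Hypothesis Lb_gt0 : 0 < Lb.
Hypothesis L_ge0 : 0 <= L.
Hypothesis F_lip : L.-lipschitz F.
Hypothesis F_mono : monotone_fun dot F.
Hypothesis A_mono : monotone_op dot A.
Hypothesis zstar_sol : [set F zstar + u | u in A zstar] 0.
Variables z v : nat -> H.
Hypothesis zv : forall k, resolvent (alpha Lb k) A
  ((1 - beta k) *: z k + beta k *: z0 - alpha Lb k *: v k) (z k.+1).

Definition velocity k := z k.+1 - z k.

Definition displacement k := z0 - z k.

Definition error k := alpha Lb k *: (v k - F (z k)).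

Definition forward k := alpha Lb k *: (F (z k.+1) - F (z k)).

Definition scaled_residual k :=
  beta k *: displacement k.+1 - (1 - beta k) *: velocity k - error k + forward k.

(** For x = k + 1 the scalar is (1 - beta_k) alpha_(k+1) / alpha_k. *)
Definition drift (x : R) k :=
  ((x - 1) / (x + 5 / 2)) *: velocity k - alpha Lb k.+1 *: (F (z k.+1) - F (z k)).

(** For x = k + 1 this is (1 - gamma_(k+1)) alpha_(k+1) / alpha_k. *)
Definition retention (x : R) := (x + 3 / 2) / (x + 3).

(** Before the two resolvent inclusions are subtracted, the earlier one is rescaled by the step
    ratio r = alpha_(k+1) / alpha_k. The displacement then gets beta_(k+1) - r beta_k = -(3/2) / ((x
    + 5/2) (x + 3)), and the old error gets r - retention x = (x + 9/4) / ((x + 5/2) (x + 3)). *)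
Lemma velocityS_le k (x := k.+1%:R : R) :
  dot (velocity k.+1) (velocity k.+1) <=
  dot (velocity k.+1)
    (drift x k + ((x + 9 / 4) / ((x + 5 / 2) * (x + 3))) *: error k
     - (3 / 2 / ((x + 5 / 2) * (x + 3))) *: displacement k.+1
     - (error k.+1 - retention x *: error k)).
Proof.
have [u Au uE] := zv k; have [u' Au' u'E] := zv k.+1.
have a0 := alpha_gt0 Lb_gt0 k; have a1 := alpha_gt0 Lb_gt0 k.+1.
have := mulr_ge0 (ltW a1) (A_mono Au' Au).
have {}uE : alpha Lb k *: u =
    (1 - beta k) *: z k + beta k *: z0 - alpha Lb k *: v k - z k.+1.
  by rewrite -uE addrC addKr.
have {}u'E : alpha Lb k.+1 *: u' = (1 - beta k.+1) *: z k.+1 + beta k.+1 *: z0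
    - alpha Lb k.+1 *: v k.+1 - z k.+2.
  by rewrite -u'E addrC addKr.
have auE : alpha Lb k.+1 *: u = ((k%:R + 3) / (k%:R + 7 / 2)) *: (alpha Lb k *: u).
  by rewrite scalerA -alphaS.
rewrite -[z k.+2 - z k.+1]/(velocity k.+1) -dotZl scalerBr u'E auE uE => h.
rewrite -subr_ge0 ![dot (velocity k.+1) _]dotC.
apply: le_trans h _; rewrite le_eqVlt; apply/orP; left; apply/eqP.
(* Only one factor is expanded; the other stays an opaque vector [y], so that the identity to be
   checked is linear in the iterates. *)
have := erefl (velocity k.+1); rewrite {2}/velocity.
rewrite /drift /error /displacement /retention /x.
move: (velocity k.+1) => y yE; rewrite [X in _ - dot X _]yE.
rewrite /velocity !dotE alphaS /beta -natr1.
have k0 : 0 <= k%:R :> R by [].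
field; pos_neq0.
Qed.

(** The resolvent equation contains [v k]; trading it for [F (z k.+1)] costs [error k] and
    [forward k]. In the second part, (z0 - zstar) - displacement k.+1 is z_(k+1) - z_*. *)
Lemma scaled_residualP k :
  (exists2 u, A (z k.+1) u & scaled_residual k = alpha Lb k *: (F (z k.+1) + u)) /\
  0 <= dot (scaled_residual k) ((z0 - zstar) - displacement k.+1).
Proof.
have [u Au uE] := zv k; have a0 := alpha_gt0 Lb_gt0 k.
have WE : scaled_residual k = alpha Lb k *: (F (z k.+1) + u).
  rewrite scalerDr.
  have -> : alpha Lb k *: u =
      (1 - beta k) *: z k + beta k *: z0 - alpha Lb k *: v k - z k.+1.
    by rewrite -uE addrC addKr.
  apply: dot_inj => t.
  by rewrite /scaled_residual /displacement /velocity /error /forward !dotE; ring.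
split; first by exists u.
have [us Aus us0] := zstar_sol.
rewrite WE dotZl mulr_ge0 ?(ltW a0) //.
have -> : z0 - zstar - displacement k.+1 = z k.+1 - zstar.
  by apply: dot_inj => t; rewrite /displacement !dotE; ring.
have := addr_ge0 (F_mono (z k.+1) zstar) (A_mono Au Aus).
by rewrite -dotDl addrACA -opprD us0 subr0.
Qed.

Lemma forward_ge0 k : 0 <= dot (forward k) (velocity k).
Proof. by rewrite dotZl mulr_ge0 ?F_mono // ltW // alpha_gt0. Qed.

Lemma F_dist_le x y : dot (F x - F y) (F x - F y) <= L ^+ 2 * dot (x - y) (x - y).
Proof.
rewrite !Hdot -exprMn lerXn2r ?nnegrE ?mulr_ge0 //.
exact: (@F_lip (x, y) (conj I I)).
Qed.

Lemma forward_le k :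
  dot (forward k) (forward k) <= alpha Lb k ^+ 2 * L ^+ 2 * dot (velocity k) (velocity k).
Proof.
by rewrite dotZl dotZr mulrA -expr2 -mulrA ler_wpM2l ?sqr_ge0 // F_dist_le.
Qed.

Lemma drift_le k (x := k.+1%:R : R) :
  dot (drift x k) (drift x k) <= (((x - 1) / (x + 5 / 2)) ^+ 2 +
    alpha Lb k.+1 ^+ 2 * L ^+ 2) * dot (velocity k) (velocity k).
Proof.
apply: damped_le.
- rewrite divr_ge0 // /x -natr1; have k0 : 0 <= k%:R :> R by []; lra.
- by rewrite dotZl mulr_ge0 ?F_mono // ltW // alpha_gt0.
- by rewrite dotZl dotZr mulrA -expr2 -mulrA ler_wpM2l ?sqr_ge0 // F_dist_le.
Qed.

(** The fresh noise d1 - (1 - gamma) d0 is regrouped into an increment, governed by [LDelta], and a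
    small multiple of [d1], governed by [sigma]. *)
Lemma errorS k (d1 d0 : H) (x := k.+1%:R : R) :
  v k.+1 = F (z k.+1) + d1 + (1 - gamma_next k) *: (v k - (F (z k) + d0)) ->
  error k.+1 - retention x *: error k =
  alpha Lb k.+1 *: ((1 - mixing x) *: (d1 - d0) + mixing x *: d1).
Proof.
move=> vE; apply: dot_inj => t.
have gE : gamma_next k = mixing x :> R.
  rewrite /gamma_next /mixing /x -natr1; have k0 : 0 <= k%:R :> R by [].
  by field; pos_neq0.
rewrite /error vE gE !dotE alphaS /retention /mixing /x -natr1.
have k0 : 0 <= k%:R :> R by [].
by field; pos_neq0.
Qed.

End trajectory.

(** * The expected potential *)

Lemma edist_inf_le_norm {R : realType} {V : normedModType R} (E : set V) (x y : V) :
  E y -> (edist_inf E x <= (`|y - x|)%:E)%E.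
Proof.
move=> Ey; apply: (@le_trans _ _ (edist (x, y))).
  by apply: ereal_inf_lbound; exists y.
apply/lee_addgt0Pr => e e0; rewrite -EFinD; apply: edist_fin.
  by rewrite ltr_wpDl.
by rewrite /= -ball_normE /ball_ /= distrC ltrDl.
Qed.

Section expected_potential.
Context {R : realType} {H : completeNormedModType R}.
Variable dot : {dot H for idfun}.
Hypothesis Hdot : hilbert_norm dot.
Context {dO dS : measure_display}.
Context {Omega : measurableType dO} {S : measurableType dS}.
Variables (mu : probability S R) (P : probability Omega R).
Variable xi : nat -> {mfun Omega >-> S}.
Hypothesis xi_law : forall i B, measurable B -> distribution P (xi i) B = mu B.
Hypothesis xi_indep : mutually_independent P xi.
Variables (delta : S -> H -> H) (sigma LDelta : R).
Hypothesis delta_meas : measurable_fun setT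
     ((fun p => delta p.1 p.2) : S * borel H -> borel H).
Hypothesis delta_mean : forall z, is_bochner_integral mu (delta ^~ z) 0.
Hypothesis delta_var : forall z,
     (\int[mu]_s (`|delta s z| ^+ 2)%:E <= (sigma ^+ 2)%:E)%E.
Hypothesis delta_lip : forall x y,
     (\int[mu]_s (`|delta s x - delta s y| ^+ 2)%:E
        <= (LDelta ^+ 2 * `|x - y| ^+ 2)%:E)%E.
Variable c : nat -> H.
Let K := closure_seq c.
Hypothesis KD : forall x y, K x -> K y -> K (x + y).
Hypothesis KZ : forall a x, K x -> K (a *: x).
Hypothesis delta_K : forall x, K x -> mu (delta ^~ x @^-1` (~` K)) = 0%E.
Variables (L Lb : R) (F : H -> H) (A : H -> set H) (z0 zstar : H).
Hypothesis L_ge0 : 0 <= L.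
Hypothesis Lb_gt0 : 0 < Lb.
Hypothesis LbE : Lb ^+ 2 = L ^+ 2 + LDelta ^+ 2.
Hypothesis F_mono : monotone_fun dot F.
Hypothesis F_lip : L.-lipschitz F.
Hypothesis A_mono : monotone_op dot A.
Hypothesis zstar_sol : [set F zstar + u | u in A zstar] 0.
Hypothesis KF : forall x, K x -> K (F x).
Hypothesis Kz0 : K z0.
Hypothesis Kzstar : K zstar.
Variables z v : nat -> Omega -> H.
Hypothesis zv : is_vraf Lb F A z0 delta (fun i => xi i) z v.
Variable D : set Omega.

Notation past k := (g_sigma_algebraType (past_generator P xi k)).

Hypothesis mD : forall k, measurable (D : set (past k)).
Hypothesis mz : forall k, meas_in c (D : set (past k)) (z k).
Hypothesis mv : forall k, meas_in c (D : set (past k.+1)) (v k).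
Hypothesis Kdelta : forall k w, D w ->
  K (delta (xi k w) (z k w)) /\ K (delta (xi k w) (z k.-1 w)).

Let mDO : measurable D.
Proof. exact: past_sub (@mD 0%N). Qed.

Let K0 : K 0.
Proof. by rewrite -(scale0r z0); exact: KZ. Qed.

Notation square_int := (sqint_in dot P c D).
Notation Dmean := (mean_in P D).
Notation Dint := (int_in P D).

Let zw w k := z k w.
Let vw w k := v k w.
Let vel k w := velocity (zw w) k.
Let disp k w := displacement z0 (zw w) k.
Let err k w := error Lb F (zw w) (vw w) k.
Let res k w := scaled_residual Lb F z0 (zw w) (vw w) k.
Let noise k w := err k.+1 w - retention k.+1%:R *: err k w.

(** * Square integrability and centring along the trajectory *)

Lemma past_meas_in k X : meas_in c (D : set (past k)) X -> meas_in c D X.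
Proof.
move=> [mX XK]; split => // _ B mB; exact: past_sub (mX (@mD k) B mB).
Qed.

Lemma sqint_in_ereal X : meas_in c D X ->
  (\int[P]_(w in D) (`|X w| ^+ 2)%:E < +oo)%E -> square_int X.
Proof.
move=> mX Xoo; split => //; apply/integrableP; split.
  by apply/measurable_EFinP; exact: (meas_in_dot KD KZ Hdot).
apply: le_lt_trans Xoo; rewrite le_eqVlt; apply/orP; left; apply/eqP.
by apply: eq_integral => w _; rewrite /= Hdot ger0_norm ?exprn_ge0.
Qed.

Lemma mean_in_EFin X : square_int X ->
  ((Dmean (fun w => dot (X w) (X w)))%:E = \int[P]_(w in D) (`|X w| ^+ 2)%:E)%E.
Proof.
move=> [_ iX]; rewrite /mean_in fineK; last exact: integrable_fin_num.
by apply: eq_integral => w _; rewrite Hdot.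
Qed.

Lemma delta_past k j : (j <= k)%N -> (forall w, D w -> K (delta (xi k w) (z j w))) ->
  [/\ meas_in c (D : set (past k)) (z j),
      meas_in c (D : set (past k.+1)) (fun w => delta (xi k w) (z j w)) &
      square_int (fun w => delta (xi k w) (z j w))].
Proof.
move=> jk Kj.
have mzj : meas_in c (D : set (past k)) (z j).
  elim: k jk {Kj} => [|k IH]; first by rewrite leqn0 => /eqP ->.
  by rewrite leq_eqVlt => /predU1P[->//|/IH]; apply: meas_in_past.
have [mD' _ mX] := sampled_meas_in xi_law xi_indep delta_meas K0 delta_K (@mD k) mzj.
have {}mX : meas_in c (D : set (past k.+1)) (fun w => delta (xi k w) (z j w)).
  by apply: meas_inS mX => // w Dw; split => //; exact: Kj.
split => //; apply: sqint_in_ereal; first exact: past_meas_in mX.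
apply: le_lt_trans (ltry (sigma ^+ 2)).
exact: (noise_second_moment xi_law xi_indep delta_meas delta_var K0 (@mD k) mzj Kj).
Qed.

Lemma sqint_in_F X : square_int X -> square_int (fun w => F (X w)).
Proof.
move=> sX; have sLX : square_int (fun w => L *: X w) by exact: sqint_inZ.
apply: (sqint_in_bound Hdot KD KZ mDO (a := L * `|z0| + `|F z0|) sLX).
  exact: (meas_in_F F_lip KF mDO sX.1).
move=> w _; rewrite normrZ ger0_norm // addrA -mulrDr.
rewrite -[F (X w)](subrK (F z0)) (le_trans (ler_normD _ _)) // lerD2r.
apply: le_trans (@F_lip (X w, z0) (conj I I)) _ => /=.
by rewrite ler_wpM2l // ler_normB.
Qed.

(** All maps in the update grow at most affinely: [F] is compared with its value at [z0], and the
    resolvent with its value [zstar] at the point zstar + alpha_k us. *)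
Lemma sqint_in_zv k : square_int (z k) /\ square_int (v k).
Proof.
have Kd k' : forall w, D w -> K (delta (xi k' w) (z k' w)) by move=> w /(Kdelta k')[].
elim: k => [|k [sz sv]].
  have sz : square_int (z 0%N).
    apply: (sqint_in_eq mDO (X := fun=> z0)); last exact: (sqint_in_cst dot P mDO Kz0).
    by move=> w _; have [->] := zv w.
  split => //; have [_ _ sd] := delta_past (leqnn 0) (Kd 0%N).
  apply: (sqint_in_eq mDO (X := fun w => F (z 0%N w) + delta (xi 0%N w) (z 0%N w))).
    by move=> w _; have [-> -> _ _] := zv w.
  by apply: (sqint_inD Hdot KD KZ mDO) => //; exact: sqint_in_F.
have sx : square_int (fun w =>
    (1 - beta k) *: z k w + beta k *: z0 - alpha Lb k *: v k w).
  apply: (sqint_inB Hdot KD KZ mDO); last exact: sqint_inZ.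
  apply: (sqint_inD Hdot KD KZ mDO); first exact: sqint_inZ.
  exact: (sqint_in_cst dot P mDO (KZ _ Kz0)).
have [us Aus us0] := zstar_sol.
have sz1 : square_int (z k.+1).
  apply: (sqint_in_bound Hdot KD KZ mDO (a := `|zstar + alpha Lb k *: us| + `|zstar|) sx).
    exact: past_meas_in (@mz k.+1).
  move=> w _; have [_ _ /(_ k) zx _] := zv w.
  have zs : resolvent (alpha Lb k) A (zstar + alpha Lb k *: us) zstar by exists us.
  have := resolvent_nonexpansive Hdot A_mono (ltW (alpha_gt0 Lb_gt0 k)) zx zs.
  set x := (_ - alpha Lb k *: v k w) => h.
  rewrite -[z k.+1 w](subrK zstar) addrA (le_trans (ler_normD _ _)) // lerD2r.
  by apply: (le_trans h); rewrite ler_normB.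
split => //; have [_ _ sd1] := delta_past (leqnn k.+1) (Kd k.+1).
have [||_ _ sd0] := @delta_past k.+1 k => //; first by move=> w /(Kdelta k.+1)[].
apply: (sqint_in_eq mDO (X := fun w =>
  F (z k.+1 w) + delta (xi k.+1 w) (z k.+1 w) + (1 - gamma_next k) *:
    (v k w - (F (z k w) + delta (xi k.+1 w) (z k w))))).
  by move=> w _; have [_ _ _ ->] := zv w.
apply: (sqint_inD Hdot KD KZ mDO).
  by apply: (sqint_inD Hdot KD KZ mDO) => //; exact: sqint_in_F.
apply: sqint_inZ => //; apply: (sqint_inB Hdot KD KZ mDO) => //.
by apply: (sqint_inD Hdot KD KZ mDO) => //; exact: sqint_in_F.
Qed.

Lemma sqint_in_vel k : square_int (vel k).
Proof.
apply: (sqint_inB Hdot KD KZ mDO); first exact: (sqint_in_zv k.+1).1.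
exact: (sqint_in_zv k).1.
Qed.

Lemma sqint_in_disp k : square_int (disp k).
Proof.
apply: (sqint_inB Hdot KD KZ mDO); last exact: (sqint_in_zv k).1.
exact: (sqint_in_cst dot P mDO Kz0).
Qed.

Lemma sqint_in_err k : square_int (err k).
Proof.
apply: sqint_inZ => //; apply: (sqint_inB Hdot KD KZ mDO).
  exact: (sqint_in_zv k).2.
by apply: sqint_in_F; exact: (sqint_in_zv k).1.
Qed.

Lemma sqint_in_noise k : square_int (noise k).
Proof.
apply: (sqint_inB Hdot KD KZ mDO); first exact: sqint_in_err.
by apply: sqint_inZ => //; exact: sqint_in_err.
Qed.

Lemma noiseE k w : noise k w = alpha Lb k.+1 *:
  ((1 - mixing k.+1%:R) *: (delta (xi k.+1 w) (z k.+1 w) - delta (xi k.+1 w) (z k w))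
   + mixing k.+1%:R *: delta (xi k.+1 w) (z k.+1 w)).
Proof. by rewrite /noise /err; apply: (errorS Hdot); rewrite /vw; have [_ _ _ ->] := zv w. Qed.

Lemma delta_dot_mean k j Y : (j <= k)%N ->
  (forall w, D w -> K (delta (xi k w) (z j w))) ->
  meas_in c (D : set (past k)) Y -> square_int Y ->
  Dmean (fun w => dot (delta (xi k w) (z j w)) (Y w)) = 0.
Proof.
move=> jk Kj mY sY; have [mzj _ sd] := delta_past jk Kj.
have iD := sqint_in_dot Hdot KD KZ mDO sd sY.
rewrite /mean_in /Rintegral.
by rewrite (noise_dot_mean Hdot xi_law xi_indep delta_meas delta_mean delta_var K0 KD KZ
  delta_K (@mD k) mzj mY Kj iD).
Qed.

Lemma noise_dot_mean0 k Y : meas_in c (D : set (past k.+1)) Y -> square_int Y ->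
  Dmean (fun w => dot (noise k w) (Y w)) = 0.
Proof.
move=> mY sY.
have K1 w : D w -> K (delta (xi k.+1 w) (z k.+1 w)) by case/(Kdelta k.+1).
have K2 w : D w -> K (delta (xi k.+1 w) (z k w)) by case/(Kdelta k.+1).
have [_ _ s1] := delta_past (leqnn k.+1) K1.
have [_ _ s2] := delta_past (leqnSn k) K2.
have i1 := sqint_in_dot Hdot KD KZ mDO s1 sY.
have i2 := sqint_in_dot Hdot KD KZ mDO s2 sY.
have E1 := delta_dot_mean (leqnn k.+1) K1 mY sY.
have E2 := delta_dot_mean (leqnSn k) K2 mY sY.
set g : R := mixing k.+1%:R.
transitivity (Dmean (fun w => alpha Lb k.+1 * (dot (delta (xi k.+1 w) (z k.+1 w)) (Y w)
   - (1 - g) * dot (delta (xi k.+1 w) (z k w)) (Y w)))).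
  by apply: mean_in_eq => w _; rewrite noiseE !dotE -/g; ring.
rewrite mean_inZ ?mean_inB ?mean_inZ //; first by rewrite E1 E2; ring.
- exact: int_inZ.
- by apply: int_inB => //; exact: int_inZ.
Qed.

Lemma noise_sq_le k (g := mixing k.+1%:R) :
  Dmean (fun w => dot (noise k w) (noise k w)) <= alpha Lb k.+1 ^+ 2 *
  (3 / 2 * (1 - g) ^+ 2 * LDelta ^+ 2 * Dmean (fun w => dot (vel k w) (vel k w))
   + 3 * g ^+ 2 * sigma ^+ 2).
Proof.
have K1 w : D w -> K (delta (xi k.+1 w) (z k.+1 w)) by case/(Kdelta k.+1).
have K2 w : D w -> K (delta (xi k.+1 w) (z k w)) by case/(Kdelta k.+1).
have [mz1 _ s1] := delta_past (leqnn k.+1) K1.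
have [mz2 _ s2] := delta_past (leqnSn k) K2.
have s12 := sqint_inB Hdot KD KZ mDO s1 s2.
have i1 := sqint_in_dot Hdot KD KZ mDO s1 s1.
have i12 := sqint_in_dot Hdot KD KZ mDO s12 s12.
have sv := sqint_in_vel k; have iv := sqint_in_dot Hdot KD KZ mDO sv sv.
have E1 : Dmean (fun w => dot (delta (xi k.+1 w) (z k.+1 w)) (delta (xi k.+1 w) (z k.+1 w)))
    <= sigma ^+ 2.
  rewrite -lee_fin mean_in_EFin //.
  exact: (noise_second_moment xi_law xi_indep delta_meas delta_var K0 (@mD k.+1) mz1 K1).
have E2 := noise_increment_moment xi_law xi_indep delta_meas delta_lip K0 KD KZ
  (@mD k.+1) mz1 mz2 K1 K2.
have {}E2 : Dmean (fun w =>
    dot (delta (xi k.+1 w) (z k.+1 w) - delta (xi k.+1 w) (z k w))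
        (delta (xi k.+1 w) (z k.+1 w) - delta (xi k.+1 w) (z k w)))
    <= LDelta ^+ 2 * Dmean (fun w => dot (vel k w) (vel k w)).
  rewrite -lee_fin mean_in_EFin //; apply: (le_trans E2).
  rewrite -mean_inZ // /mean_in fineK; last exact: integrable_fin_num (int_inZ mDO _ iv).
  rewrite le_eqVlt; apply/orP; left; apply/eqP; apply: eq_integral => w _.
  by rewrite Hdot.
have G0 : 0 <= 3 / 2 * (1 - g) ^+ 2 by rewrite mulr_ge0 ?sqr_ge0.
have G1 : 0 <= 3 * g ^+ 2 by rewrite mulr_ge0 ?sqr_ge0.
apply: (@le_trans _ _ (Dmean (fun w => alpha Lb k.+1 ^+ 2 *
  (3 / 2 * (1 - g) ^+ 2 *
     dot (delta (xi k.+1 w) (z k.+1 w) - delta (xi k.+1 w) (z k w))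
         (delta (xi k.+1 w) (z k.+1 w) - delta (xi k.+1 w) (z k w))
   + 3 * g ^+ 2 * dot (delta (xi k.+1 w) (z k.+1 w)) (delta (xi k.+1 w) (z k.+1 w)))))).
  apply: mean_in_le => //.
  - exact: (sqint_in_noise k).2.
  - by apply: int_inZ => //; apply: int_inD => //; exact: int_inZ.
  move=> w _; rewrite noiseE -/g dotZl dotZr mulrA -expr2 ler_wpM2l ?sqr_ge0 //.
  apply: le_trans (young_le _ _ _) _.
  by rewrite !dotZl !dotZr; lra.
rewrite mean_inZ ?mean_inD ?mean_inZ //; do ?[exact: int_inZ].
  rewrite ler_wpM2l ?sqr_ge0 // lerD //; last exact: ler_wpM2l.
  by rewrite -[leRHS]mulrA; exact: ler_wpM2l.
by apply: int_inD => //; exact: int_inZ.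
Qed.

Lemma meas_in_err k : meas_in c (D : set (past k.+1)) (err k).
Proof.
apply: meas_inZ => //; apply: (meas_inB KD KZ (@mD k.+1)) => //.
apply: (meas_in_F F_lip KF (@mD k.+1)).
exact: meas_in_past (@mD k) (@mz k).
Qed.

Let u := z0 - zstar.

Lemma sqint_in_u : square_int (fun=> u).
Proof.
apply: (sqint_in_cst dot P mDO); apply: KD => //.
by rewrite -scaleN1r; exact: KZ.
Qed.

(** The initial error is pure noise, and each later one is a multiple of its predecessor plus
    centred noise, so against a fixed vector the mean stays zero. *)
Lemma err_dot_u k : Dmean (fun w => dot (err k w) u) = 0.
Proof.
have Ku : K u by rewrite /u -scaleN1r; apply: KD => //; exact: KZ.
elim: k => [|k IH].
  have K1 w : D w -> K (delta (xi 0%N w) (z 0%N w)) by case/(Kdelta 0%N).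
  have [_ _ s1] := delta_past (leqnn 0) K1.
  have E1 := delta_dot_mean (leqnn 0) K1 (meas_in_cst _ Ku) sqint_in_u.
  have i1 := sqint_in_dot Hdot KD KZ mDO s1 sqint_in_u.
  rewrite -(mulr0 (alpha Lb 0)) -[in RHS]E1 -mean_inZ //; apply: mean_in_eq => w _.
  rewrite /err /error /vw /zw; have [z0w -> _ _] := zv w.
  by rewrite /sampled_operator z0w dotZl addrC addKr.
have E1 := noise_dot_mean0 (meas_in_cst _ Ku) sqint_in_u.
have i1 := sqint_in_dot Hdot KD KZ mDO (sqint_in_noise k) sqint_in_u.
have i2 := sqint_in_dot Hdot KD KZ mDO (sqint_in_err k) sqint_in_u.
transitivity (Dmean (fun w => dot (noise k w) u + retention k.+1%:R * dot (err k w) u)).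
  by apply: mean_in_eq => w _; rewrite /noise !dotE; ring.
rewrite mean_inD ?mean_inZ ?IH ?E1 //; last exact: int_inZ.
by rewrite mulr0 addr0.
Qed.

Ltac dint := repeat match goal with
  | |- is_true (int_in _ _ (fun w => @?f w + @?g w)) => apply: (int_inD mDO (f := f) (g := g))
  | |- is_true (int_in _ _ (fun w => - @?f w)) => apply: (int_inN mDO (f := f))
  | |- is_true (int_in _ _ (fun w => ?a * @?f w)) => apply: (int_inZ mDO a (f := f))
  | |- is_true (int_in _ _ _) => apply: (sqint_in_dot Hdot KD KZ mDO)
  end.

Ltac dmean := repeat first
  [rewrite (mean_inD mDO); [|by dint|by dint]
  |rewrite (mean_inN mDO); [|by dint]
  |rewrite (mean_inZ mDO); [|by dint]].

(** * Recursion for the mean potential *)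

Let Ev k := Dmean (fun w => dot (vel k w) (vel k w)).
Let Ee k := Dmean (fun w => dot (err k w) (err k w)).
Let Ep k := Dmean (fun w => dot (disp k w) (disp k w)).
Let Ec k := Dmean (fun w => dot (disp k.+1 w) (err k w)).

(** The mean of V_(k+1), not V_k: the weights are taken at x = k + 1, matching the displacement
    [k.+1] and the velocity and error [k]. *)
Definition potential k : R := let x := k.+1%:R in
  velocity_weight x * Ev k + (x + 2) ^+ 2 * Ee k - 3 / 2 * Ep k.+1
  + cross_weight x * Ec k.

Let bias k w := drift Lb F (zw w) k.+1%:R k.

Lemma sqint_in_bias k : square_int (bias k).
Proof.
apply: (sqint_inB Hdot KD KZ mDO); first by apply: sqint_inZ => //; exact: sqint_in_vel.
apply: sqint_inZ => //; apply: (sqint_inB Hdot KD KZ mDO); apply: sqint_in_F;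
  exact: (sqint_in_zv _).1.
Qed.

Lemma meas_in_bias k : meas_in c (D : set (past k.+1)) (bias k).
Proof.
have mzk := meas_in_past (@mD k) (@mz k).
apply: (meas_inB KD KZ (@mD k.+1)); apply: meas_inZ => //;
  apply: (meas_inB KD KZ (@mD k.+1)) => //; exact: (meas_in_F F_lip KF (@mD k.+1)).
Qed.

Lemma meas_in_disp k : meas_in c (D : set (past k)) (disp k).
Proof. by apply: (meas_inB KD KZ (@mD k)) => //; exact: meas_in_cst. Qed.

Lemma potential_step k (x := k.+1%:R : R) (a2 := alpha Lb k.+1 ^+ 2) (g := mixing x)
    (Q := (x + 5 / 2) * (x + 3)) :
  potential k.+1 <=
  (Q * (((x - 1) / (x + 5 / 2)) ^+ 2 + a2 * L ^+ 2)
   + noise_weight x * a2 * (3 / 2 * (1 - g) ^+ 2 * LDelta ^+ 2)) * Ev k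
  + (x + 3 / 2) ^+ 2 * Ee k - 3 / 2 * Ep k.+1 + 2 * (x + 9 / 4) * Ec k
  + 3 * noise_weight x * a2 * g ^+ 2 * sigma ^+ 2.
Proof.
have x0 : 0 < x by rewrite /x ltr0n.
have sv := sqint_in_vel; have se := sqint_in_err; have sp := sqint_in_disp.
have sn := sqint_in_noise; have sb := sqint_in_bias.
have Q0 : 0 < Q by rewrite mulr_gt0 //; lra.
have Q0' : Q != 0 by rewrite gt_eqF.
(* Solves [chi * ka = 2 * (x + 9 / 4)], as the error coefficient in [velocityS_le] requires. It is
   also [cross_weight (x + 1)], so the left side of [velocity_step] becomes the next potential. *)
pose chi := 2 * (x + 9 / 4) * (x + 3) / (x + 3 / 2).
pose f := 3 / 2 / Q.
pose ka := retention x.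
pose G := (x + 3) ^+ 2.
have chika : chi * ka = 2 * (x + 9 / 4) by rewrite /chi /ka /retention; field; pos_neq0.
have QfE : Q * f = 3 / 2 by rewrite /f mulrC divfK.
have NWE : (Q + chi / 2) ^+ 2 / Q + G = noise_weight x.
  by rewrite /noise_weight /chi /Q /G; field; pos_neq0.
have GkaE : G * ka ^+ 2 = (x + 3 / 2) ^+ 2.
  by rewrite /G /ka /retention; field; pos_neq0.
have xS : k.+2%:R = x + 1 :> R by rewrite /x natr1.
have pw w : D w -> (Q + Q * f) * dot (vel k.+1 w) (vel k.+1 w)
    + G * dot (err k.+1 w) (err k.+1 w) - Q * f * dot (disp k.+2 w) (disp k.+2 w)
    + chi * dot (disp k.+2 w) (err k.+1 w) <=
  Q * dot (bias k w) (bias k w) + noise_weight x * dot (noise k w) (noise k w)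
    + (x + 3 / 2) ^+ 2 * dot (err k w) (err k w)
    - Q * f * dot (disp k.+1 w) (disp k.+1 w)
    + 2 * (x + 9 / 4) * dot (disp k.+1 w) (err k w)
    + (- (2 * Q + chi) * dot (noise k w) (bias k w)
       + 2 * G * ka * dot (noise k w) (err k w)
       + chi * dot (noise k w) (disp k.+1 w)).
  move=> _; have [_ _ zr _] := zv w.
  have := velocityS_le F Lb_gt0 A_mono zr k.
  cbv zeta; rewrite -/x.
  have -> : (x + 9 / 4) / ((x + 5 / 2) * (x + 3)) = chi * ka / (2 * Q).
    by rewrite chika -/Q; field; exact: Q0'.
  move/(velocity_step (chi := chi) (ka := ka) G Q0).
  rewrite -/x -/(bias k w) -/(noise k w) NWE GkaE chika.
  have -> : ka *: err k w + noise k w = err k.+1 w by rewrite /noise addrC subrK.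
  have -> : displacement z0 (zw w) k.+1 - velocity (zw w) k.+1 = disp k.+2 w.
    by rewrite /disp /displacement /velocity opprB addrA subrK.
  exact.
have := fun i1 i2 => mean_in_le (P := P) mDO i1 i2 pw.
move=> /(_ ltac:(by dint) ltac:(by dint)).
dmean.
dmean.
have mp := @meas_in_disp k.+1.
(* The vectors [bias k], [err k] and [disp k.+1] are functions of the samples up to index [k], given
   which [noise k] is centred. *)
rewrite (noise_dot_mean0 (meas_in_bias k) (sb k)).
rewrite (noise_dot_mean0 (meas_in_err k) (se k)).
rewrite (noise_dot_mean0 mp (sp k.+1)).
rewrite !mulr0 !addr0 QfE => main.
have hb : Dmean (fun w => dot (bias k w) (bias k w)) <=
    (((x - 1) / (x + 5 / 2)) ^+ 2 + a2 * L ^+ 2) * Ev k.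
  rewrite /Ev -(mean_inZ mDO); last by dint.
  apply: (mean_in_le mDO); [by dint|by dint|move=> w _].
  exact: drift_le.
have hn := noise_sq_le k.
have nw0 : 0 <= noise_weight x by apply: noise_weight_ge0; exact: ltW.
have := ler_wpM2l (ltW Q0) hb; have := ler_wpM2l nw0 hn.
rewrite /potential xS; move: main.
have -> : velocity_weight (x + 1) = Q + 3 / 2 by rewrite /velocity_weight /Q; field.
have -> : cross_weight (x + 1) = chi.
  by rewrite /cross_weight /chi; field; pos_neq0.
have -> : (x + 1 + 2) ^+ 2 = G by rewrite /G; ring.
rewrite -/(Ev k.+1) -/(Ee k.+1) -/(Ep k.+2) -/(Ec k.+1) -/(Ev k) -/(Ee k).
rewrite -/(Ep k.+1) -/(Ec k) -/x -/g -/a2.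
lra.
Qed.

Let s2 := sigma ^+ 2 / Lb ^+ 2.
Let th k := theta Lb k.

Lemma s2_ge0 : 0 <= s2.
Proof. by rewrite divr_ge0 ?sqr_ge0. Qed.

Lemma theta_s2 k : alpha Lb k ^+ 2 * sigma ^+ 2 = th k * s2.
Proof. by rewrite /th /theta /s2; field; rewrite gt_eqF. Qed.

Lemma theta_L k : alpha Lb k ^+ 2 * L ^+ 2 + alpha Lb k ^+ 2 * LDelta ^+ 2 = th k.
Proof. by rewrite -mulrDr -LbE /th /theta exprMn. Qed.

Lemma Ev_ge0 k : 0 <= Ev k.
Proof. by apply: mean_in_ge0 => w _; exact: dot_ge0. Qed.

Lemma Ee_ge0 k : 0 <= Ee k.
Proof. by apply: mean_in_ge0 => w _; exact: dot_ge0. Qed.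

Lemma Ep_ge0 k : 0 <= Ep k.
Proof. by apply: mean_in_ge0 => w _; exact: dot_ge0. Qed.

(** The cross terms match exactly. The displacement term needs only [decay x <= 1], because its
    weight in the potential is negative. *)
Lemma potential_decay k (x := k.+1%:R : R) : (0 < k)%N ->
  potential k.+1 <= decay x * potential k + 14 * (1 - decay x) * s2.
Proof.
move=> k0; have x2 : 2 <= x by rewrite /x ler_nat.
have := potential_step k; cbv zeta; rewrite -/x.
set a2 := alpha Lb k.+1 ^+ 2; set nw := noise_weight x; set g := mixing x.
move/le_trans; apply.
have a20 : 0 <= a2 by exact: sqr_ge0.
have t0 : 0 <= th k.+1 by exact: theta_ge0.
have tx : th k.+1 * (72 * (5 * x + 14)) <= 343 by exact: theta_le.
have nwE : nw * (1 - g) ^+ 2 = (x + 5 / 2) * (x + 3)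
    + ((x + 3 / 2) * (x + 5 / 2) / (x + 2)) ^+ 2.
  by apply: noise_weightE; lra.
have hv := velocity_decay x2 t0 tx; have hn := noise_decay x2 t0 tx.
have he := error_decay x2.
have d1 : decay x <= 1 by rewrite /decay ler_pdivrMr; nra.
have QrE : (x + 5 / 2) * (x + 3) * ((x - 1) / (x + 5 / 2)) ^+ 2 =
    (x - 1) ^+ 2 * (x + 3) / (x + 5 / 2) by field; pos_neq0.
have dcE : decay x * cross_weight x = 2 * (x + 9 / 4).
  by rewrite /decay /cross_weight; field; pos_neq0.
have Y0 := sqr_ge0 ((x + 3 / 2) * (x + 5 / 2) / (x + 2)).
have Q0 : 0 <= (x + 5 / 2) * (x + 3) by rewrite mulr_ge0 //; lra.
have aL : 0 <= a2 * L ^+ 2 by rewrite mulr_ge0 ?sqr_ge0.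
(* The weight of [L ^+ 2] is enlarged to that of [LDelta ^+ 2], so that the two constants enter only
   through their sum [Lb ^+ 2]. *)
have h1 : (x + 5 / 2) * (x + 3) * (a2 * L ^+ 2) <=
    3 / 2 * (nw * (1 - g) ^+ 2) * (a2 * L ^+ 2).
  by rewrite ler_wpM2r // nwE; lra.
have tE := theta_L k.+1; rewrite -/a2 in tE.
have coef : (x + 5 / 2) * (x + 3) * (((x - 1) / (x + 5 / 2)) ^+ 2 + a2 * L ^+ 2)
    + nw * a2 * (3 / 2 * (1 - g) ^+ 2 * LDelta ^+ 2) <= decay x * velocity_weight x.
  apply: le_trans hv; rewrite -QrE -/nw -/g -tE.
  lra.
have s20 := s2_ge0.
have tsE := theta_s2 k.+1; rewrite -/a2 in tsE.
have noiseb : 3 * nw * a2 * g ^+ 2 * sigma ^+ 2 <= 14 * (1 - decay x) * s2.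
  have := ler_wpM2r s20 hn; rewrite -/nw -/g; apply: le_trans.
  by rewrite le_eqVlt; apply/orP; left; apply/eqP; ring: tsE.
have := ler_wpM2r (Ev_ge0 k) coef.
have := ler_wpM2r (Ee_ge0 k) he.
have := ler_wpM2r (Ep_ge0 k.+1) d1.
rewrite /potential -/x -dcE; lra.
Qed.

(** * Initial values and the bound on the potential *)

Variable rho : R.
Hypothesis z0_dist : `|z0 - zstar| <= rho.

Lemma u_le : dot u u <= rho ^+ 2.
Proof. by rewrite Hdot lerXn2r ?nnegrE // (le_trans _ z0_dist). Qed.

Lemma mean_in_u_le : Dmean (fun=> dot u u) <= rho ^+ 2.
Proof.
by apply: le_trans u_le; apply: mean_in_cst_le => //; exact: dot_ge0.
Qed.

Lemma Ee0_le : Ee 0 <= 49 / 144 * s2.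
Proof.
have K1 w : D w -> K (delta (xi 0%N w) (z 0%N w)) by case/(Kdelta 0%N).
have [mz1 _ s1] := delta_past (leqnn 0) K1.
have i1 := sqint_in_dot Hdot KD KZ mDO s1 s1.
rewrite -(theta0 Lb_gt0) -/(th 0) -theta_s2.
have <- : Dmean (fun w => alpha Lb 0 ^+ 2 *
    dot (delta (xi 0%N w) (z 0%N w)) (delta (xi 0%N w) (z 0%N w))) = Ee 0.
  apply: mean_in_eq => w _.
  rewrite /err /error /vw /zw; have [z0w -> _ _] := zv w.
  by rewrite /sampled_operator z0w addrC addKr dotZl dotZr mulrA expr2.
rewrite mean_inZ // ler_wpM2l ?sqr_ge0 // -lee_fin mean_in_EFin //.
exact: (noise_second_moment xi_law xi_indep delta_meas delta_var K0 (@mD 0%N) mz1 K1).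
Qed.

Lemma first_residual w : res 0 w = forward Lb F (zw w) 0 - vel 0 w - err 0 w /\
  disp 1 w = - vel 0 w.
Proof.
have pE : disp 1 w = - vel 0 w.
  have [z0w _ _ _] := zv w.
  by rewrite /disp /vel /displacement /velocity /zw z0w opprB.
split => //; rewrite /res /scaled_residual -/(disp 1 w) -/(vel 0 w) -/(err 0 w) pE.
by apply: (dot_inj Hdot) => t; rewrite !dotE /beta; field.
Qed.

Lemma res_ge0 k w : 0 <= dot (res k w) (u - disp k.+1 w).
Proof.
have [_ _ zr _] := zv w.
exact: (scaled_residualP Hdot Lb_gt0 F_mono A_mono zstar_sol zr k).2.
Qed.

Lemma sqint_in_forward k : square_int (fun w => forward Lb F (zw w) k).
Proof.
apply: sqint_inZ => //; apply: (sqint_inB Hdot KD KZ mDO); apply: sqint_in_F;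
  exact: (sqint_in_zv _).1.
Qed.

Lemma sqint_in_res k : square_int (res k).
Proof.
apply: (sqint_inD Hdot KD KZ mDO); last exact: sqint_in_forward.
apply: (sqint_inB Hdot KD KZ mDO); last exact: sqint_in_err.
apply: (sqint_inB Hdot KD KZ mDO); apply: sqint_inZ => //.
  exact: sqint_in_disp.
exact: sqint_in_vel.
Qed.

(** At x = 1 the damping coefficient x - 1 of the drift vanishes, [disp 1] is minus [vel 0] and
    [err 0] is pure noise. The one-step bound thus involves two vectors only, and monotonicity at
    the solution controls them. *)
Lemma potential1_le : potential 1 <= 15 / 2 * rho ^+ 2 + 14 * s2.
Proof.
have sv := sqint_in_vel; have se := sqint_in_err; have su := sqint_in_u.
pose l := L ^+ 2 / Lb ^+ 2.
have Lb2 : 0 < Lb ^+ 2 by rewrite exprn_gt0.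
have l0 : 0 <= l <= 1.
  rewrite divr_ge0 ?sqr_ge0 //= ler_pdivrMr // mul1r LbE lerDl sqr_ge0 //.
have pw w : D w -> (7 / 2 * l + 3241 / 384 * (1 - l) - 3 / 2) * dot (vel 0 w) (vel 0 w)
    + 25 / 4 * dot (err 0 w) (err 0 w) - 13 / 2 * dot (vel 0 w) (err 0 w) <=
    15 / 2 * dot u u + 34 * dot (err 0 w) (err 0 w) + 1169 / 841 * dot (err 0 w) u.
  move=> _; apply: (potential2_le (psi := forward Lb F (zw w) 0) l0).
    apply: le_trans (forward_le Hdot Lb L_ge0 F_lip (zw w) 0) _.
    rewrite ler_wpM2r ?dot_ge0 // -(theta0 Lb_gt0) /theta /l.
    by rewrite le_eqVlt; apply/orP; left; apply/eqP; field; rewrite gt_eqF.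
  have := res_ge0 0 w; have [-> ->] := first_residual w.
  by rewrite opprK.
have := fun i1 i2 => mean_in_le (P := P) mDO i1 i2 pw.
move=> /(_ ltac:(by dint) ltac:(by dint)).
dmean.
rewrite err_dot_u mulr0 addr0 -/(Ev 0) -/(Ee 0) => main.
have EpE : Ep 1 = Ev 0.
  apply: mean_in_eq => w _; have [_ ->] := first_residual w.
  by rewrite dotNl dotNr opprK.
have EcE : Ec 0 = - Dmean (fun w => dot (vel 0 w) (err 0 w)).
  rewrite -(mean_inN mDO); last by dint.
  by apply: mean_in_eq => w _; have [_ ->] := first_residual w; rewrite dotNl.
have := potential_step 0; cbv zeta; rewrite -[1%:R]/(1 : R).
rewrite EpE EcE => /le_trans; apply.
set a2 := alpha Lb 1 ^+ 2.
have a2E : a2 * Lb ^+ 2 = 1 / 4 by rewrite -(theta1 Lb_gt0) /theta exprMn.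
have a2L : a2 * L ^+ 2 = 1 / 4 * l.
  by rewrite -a2E /l; field; rewrite gt_eqF.
have a2D : a2 * LDelta ^+ 2 = 1 / 4 * (1 - l).
  have -> : LDelta ^+ 2 = Lb ^+ 2 - L ^+ 2 by rewrite LbE addrC addKr.
  by rewrite mulrBr a2E a2L; ring.
have a2s : a2 * sigma ^+ 2 = 1 / 4 * s2 by rewrite theta_s2 /th theta1.
have nwg : noise_weight 1 * (1 - mixing 1) ^+ 2 = 3241 / 144 :> R.
  by rewrite /noise_weight /mixing; field.
(* The initial error uses up 34 * 49/144 of the 14 units of noise; the fresh variance has to fit
   into the rest. *)
have nwm : 3 * noise_weight 1 * mixing 1 ^+ 2 * (1 / 4) <= 14 - 34 * (49 / 144) :> R.
  have -> : noise_weight 1 = 16 * 463 / 175 :> R by rewrite /noise_weight; field.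
  have -> : mixing 1 = 13 / 48 :> R by rewrite /mixing; field.
  lra.
have e0 := Ee0_le; have uu := mean_in_u_le; have s20 := s2_ge0.
have := ler_wpM2r s20 nwm.
have c1 : noise_weight 1 * a2 * (3 / 2 * (1 - mixing 1) ^+ 2 * LDelta ^+ 2) =
    3241 / 384 * (1 - l).
  transitivity (3 / 2 * (noise_weight 1 * (1 - mixing 1) ^+ 2) * (a2 * LDelta ^+ 2)).
    by ring.
  by rewrite nwg a2D; field.
have c2 : 3 * noise_weight 1 * a2 * mixing 1 ^+ 2 * sigma ^+ 2 =
    3 * noise_weight 1 * mixing 1 ^+ 2 * (1 / 4) * s2 by ring: a2s.
rewrite c1 c2 a2L; lra.
Qed.

Lemma potential_le k (x := k.+1%:R : R) : (0 < k)%N ->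
  potential k <= (3 + 18 / (x + 2)) * rho ^+ 2 + 14 * s2.
Proof.
rewrite {}/x; case: k => // k _; elim: k => [|k IH].
  have -> : 3 + 18 / (2%:R + 2) = 15 / 2 :> R by field.
  exact: potential1_le.
have := @potential_decay k.+1 isT; cbv zeta; set x := k.+2%:R in IH *.
move/le_trans; apply.
have x2 : 2 <= x by rewrite /x ler_nat.
have -> : k.+3%:R + 2 = x + 3 by rewrite /x -[k.+3%:R]natr1; ring.
have := ler_wpM2l (decay_ge0 (ltac:(lra) : 0 <= x)) IH.
have := ler_wpM2r (sqr_ge0 rho) (distance_decay x2).
lra.
Qed.

(** * From the potential to the residual *)

Lemma res_mean_gt0 k : (0 < k)%N ->
  Dmean (fun w => dot (res k w) (res k w)) <=
  35 * th k / (k%:R + 3) * (rho ^+ 2 + s2).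
Proof.
move=> k0; pose x := k.+1%:R : R; have x2 : 2 <= x by rewrite /x ler_nat.
have sv := sqint_in_vel; have se := sqint_in_err; have su := sqint_in_u.
have sp := sqint_in_disp; have sf := sqint_in_forward.
have sr := sqint_in_res k.
pose K2 := x + 2; have K20 : 0 < K2 by rewrite /K2; lra.
have KE : k%:R + 3 = K2 by rewrite /K2 /x -natr1; ring.
(* The scaled residual is multiplied by K2 = N + 2 with N = k + 1. Then [c2] is
   [cross_weight x / (2 * K2)], which turns the bracket of [residual_le] into a lower estimate of
   the potential; [t <= 1 / 4] uses x >= 2. *)
pose t := 1 / K2; pose c2 := (x + 5 / 4) / (x + 1 / 2).
have t01 : 0 <= t <= 1 / 4.
  apply/andP; split; first by rewrite /t divr_ge0 // ltW.
  by rewrite /t ler_pdivrMr // /K2; lra.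
have c01 : 1 <= c2 <= 1 + 6 / 5 * t.
  apply/andP; split; first by rewrite /c2 ler_pdivlMr; lra.
  rewrite -subr_ge0 /c2 /t /K2.
  have -> : 1 + 6 / 5 * (1 / (x + 2)) - (x + 5 / 4) / (x + 1 / 2) =
    (9 / 20 * (x - 2)) / ((x + 2) * (x + 1 / 2)) by field; pos_neq0.
  by rewrite divr_ge0 ?mulr_ge0 //; lra.
have [m hm] := residual_le dot t01 c01.
pose r := (x - 1) / K2.
pose X w := K2 *: (r *: vel k w - forward Lb F (zw w) k).
have pw w : D w -> K2 ^+ 2 * dot (res k w) (res k w) <=
   11 / 5 * (velocity_weight x * dot (vel k w) (vel k w)
     + (x + 2) ^+ 2 * dot (err k w) (err k w)
     - 3 / 2 * dot (disp k.+1 w) (disp k.+1 w)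
     + cross_weight x * dot (disp k.+1 w) (err k w))
   + (131 / 4 - 11 / 5 * (3 + 18 * t)) * dot u u + m * K2 * dot (err k w) u.
  move=> _; have := hm (X w) (disp k.+1 w) (K2 *: err k w) u.
  have rE : 3 *: disp k.+1 w - X w - K2 *: err k w = K2 *: res k w.
    have bE : beta k = 3 / K2 by rewrite /beta KE.
    apply: (dot_inj Hdot) => y.
    rewrite /X /r /res /scaled_residual bE -/(vel k w) -/(disp k.+1 w) -/(err k w) !dotE.
    by rewrite /K2; field; pos_neq0.
  rewrite rE dotZl => /(_ (mulr_ge0 (ltW K20) (res_ge0 k w))).
  move=> hres; have hX : (1 + 4 * t) * dot (X w) (X w) <= velocity_weight x * dot (vel k w) (vel k w).
    rewrite dotZl dotZr.
    have rge : 0 <= r by rewrite divr_ge0 //; [lra|exact: ltW].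
    have hd := damped_le rge (forward_ge0 Lb_gt0 F_mono (zw w) k)
      (forward_le Hdot Lb L_ge0 F_lip (zw w) k).
    have tk : th k * (72 * (5 * x + 9)) <= 343.
      by have := theta_le Lb_gt0 k; rewrite /th /x -natr1; lra.
    have hw := velocity_weight_ge x2 (theta_ge0 Lb k) tk.
    have aL : alpha Lb k ^+ 2 * L ^+ 2 <= th k.
      by rewrite -theta_L lerDl mulr_ge0 ?sqr_ge0.
    have d0 := dot_ge0 dot (vel k w).
    apply: le_trans (ler_wpM2r d0 hw).
    have -> : (1 + 4 * t) * (K2 * (K2 * dot (r *: vel k w - forward Lb F (zw w) k)
        (r *: vel k w - forward Lb F (zw w) k))) = (x + 2) * (x + 6) *
        dot (r *: vel k w - forward Lb F (zw w) k)
        (r *: vel k w - forward Lb F (zw w) k).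
      by rewrite /t /K2; field; pos_neq0.
    rewrite -[leRHS]mulrA ler_wpM2l //; first by rewrite mulr_ge0 //; lra.
    by apply: (le_trans hd); rewrite ler_wpM2r // lerD2l.
  have cE : 2 * c2 * K2 = cross_weight x by rewrite /c2 /K2 /cross_weight; field; pos_neq0.
  move: (X w) hX hres => Xw hX; rewrite !(dotZl dot K2) !(dotZr dot K2) -cE -/K2.
  lra.
have := fun i1 i2 => mean_in_le (P := P) mDO i1 i2 pw.
move=> /(_ ltac:(by dint) ltac:(by dint)).
dmean.
rewrite err_dot_u mulr0 addr0 -/(Ev k) -/(Ee k) -/(Ep k.+1) -/(Ec k) -/K2 => main.
have main2 := potential_le k0; cbv zeta in main2; rewrite -/x /potential -/x -/K2 in main2.
have B0 : 0 <= 131 / 4 - 11 / 5 * (3 + 18 * t) by lra.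
have hu := ler_wpM2l B0 mean_in_u_le.
have tE : 18 / K2 = 18 * t by rewrite /t mul1r.
rewrite tE in main2.
have s20 := s2_ge0.
have rs0 : 0 <= rho ^+ 2 + s2 by rewrite addr_ge0 ?sqr_ge0.
(* The distance terms add up to exactly 131/4, and the noise contributes 11/5 * 14 = 30.8, which is
   less. *)
have fin : K2 ^+ 2 * Dmean (fun w => dot (res k w) (res k w)) <=
    131 / 4 * (rho ^+ 2 + s2) by lra.
have hw := residual_weight Lb_gt0 k; rewrite KE -/(th k) in hw.
have {}fin := le_trans fin (ler_wpM2r rs0 hw).
rewrite KE -(ler_pM2l (exprn_gt0 2 K20)); apply: (le_trans fin).
rewrite le_eqVlt; apply/orP; left; apply/eqP; field.
by rewrite gt_eqF.
Qed.

Lemma res_mean0 :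
  Dmean (fun w => dot (res 0 w) (res 0 w)) <=
  35 * th 0 / 3 * (rho ^+ 2 + s2).
Proof.
have sv := sqint_in_vel; have se := sqint_in_err; have su := sqint_in_u.
have sp := sqint_in_disp; have sf := sqint_in_forward.
have sr := sqint_in_res 0.
have pw w : D w -> dot (res 0 w) (res 0 w) <=
    1715 / 432 * dot u u + 35 / 3 * dot (err 0 w) (err 0 w) - 215 / 151 * dot (err 0 w) u.
  move=> _; have := res_ge0 0 w; have [-> ->] := first_residual w; rewrite opprK.
  apply: residual1_le.
  apply: le_trans (forward_le Hdot Lb L_ge0 F_lip (zw w) 0) _.
  rewrite ler_wpM2r ?dot_ge0 // -(theta0 Lb_gt0) -/(th 0) -theta_L.
  by rewrite lerDl mulr_ge0 ?sqr_ge0.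
have := fun i1 i2 => mean_in_le (P := P) mDO i1 i2 pw.
move=> /(_ ltac:(by dint) ltac:(by dint)).
dmean.
rewrite err_dot_u mulr0 subr0 -/(Ee 0) => /le_trans; apply.
have := Ee0_le; have := mean_in_u_le; rewrite /th theta0 //; lra.
Qed.

Hypothesis PD : P (~` D) = 0%E.

Lemma residual_res_le k w :
  (residual F A (z k.+1 w) ^+ 2 <=
   ((alpha Lb k ^+ 2)^-1 * dot (res k w) (res k w))%:E)%E.
Proof.
have [_ _ zr _] := zv w; have a0 := alpha_gt0 Lb_gt0 k.
have [[a Aa aE] _] := scaled_residualP Hdot Lb_gt0 F_mono A_mono zstar_sol zr k.
rewrite -/(res k w) in aE.
have -> : (alpha Lb k ^+ 2)^-1 * dot (res k w) (res k w) = `|F (z k.+1 w) + a| ^+ 2.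
  rewrite aE -[z k.+1 w]/(zw w k.+1) Hdot normrZ gtr0_norm // exprMn mulKf //.
  by rewrite expf_neq0 // gt_eqF.
have r0 : (0 <= residual F A (z k.+1 w))%E by exact: edist_inf_ge0.
have rle : (residual F A (z k.+1 w) <= (`|F (z k.+1 w) + a|)%:E)%E.
  by rewrite -[X in (`|X|)%:E]subr0; apply: edist_inf_le_norm; exists a.
by rewrite EFin_expe lee_sqr ?lee_fin.
Qed.

Lemma residual_mean_le k B : Dmean (fun w => dot (res k w) (res k w)) <= B ->
  (\int[P]_w (residual F A (z k.+1 w) ^+ 2) <= (B / alpha Lb k ^+ 2)%:E)%E.
Proof.
move=> hB; have a0 := alpha_gt0 Lb_gt0 k.
pose f w := (alpha Lb k ^+ 2)^-1 * dot (res k w) (res k w).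
have sr := sqint_in_res k.
have fi : Dint f by rewrite /f; dint.
(* The value [+oo] off [D] dominates the residual without any knowledge of it there; [g] is
   measurable and the null set adds nothing to its integral. *)
pose g w : \bar R := if mem D w then (f w)%:E else +oo%E.
have f0 w : 0 <= f w by rewrite mulr_ge0 ?invr_ge0 ?sqr_ge0 ?dot_ge0.
have g0 w : (0 <= g w)%E by rewrite /g; case: ifP => _; rewrite ?lee_fin ?leey.
have mg : measurable_fun setT g.
  apply: measurable_fun_if => //.
    by apply: (measurable_fun_bool true); rewrite setTI preimage_mem_true.
  by rewrite setTI preimage_mem_true; exact: measurable_int fi.
apply: (@le_trans _ _ (\int[P]_w g w)%E).
  apply: le_integralT => w; first by rewrite expe2 mule_ge0 // edist_inf_ge0.
  rewrite /g; case: ifP => _; first exact: residual_res_le.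
  exact: leey.
rewrite (ge0_negligible_integral (measurableC mDO)) // setTD setCK.
have -> : (\int[P]_(w in D) g w = \int[P]_(w in D) (f w)%:E)%E.
  by apply: eq_integral => w wD; rewrite /g ifT.
have -> : (\int[P]_(w in D) (f w)%:E = (Dmean f)%:E)%E.
  by rewrite /mean_in fineK //; exact: integrable_fin_num.
rewrite lee_fin (mean_inZ mDO); last by dint.
by rewrite mulrC ler_wpM2r // invr_ge0 sqr_ge0.
Qed.

Lemma residual_bound k :
  (\int[P]_w (residual F A (z k.+1 w) ^+ 2) <=
   (35 * ((Lb ^+ 2 * rho ^+ 2 + sigma ^+ 2) / (k.+1%:R + 2)))%:E)%E.
Proof.
have a0 := alpha_gt0 Lb_gt0 k.
have -> : 35 * ((Lb ^+ 2 * rho ^+ 2 + sigma ^+ 2) / (k.+1%:R + 2)) =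
    35 * th k / (k%:R + 3) * (rho ^+ 2 + s2) / alpha Lb k ^+ 2.
  rewrite /th /theta /s2 -natr1; have k0 : 0 <= k%:R :> R by [].
  by field; rewrite ?gt_eqF //=; pos_neq0.
apply: residual_mean_le; case: k a0 => [|k] _; last exact: res_mean_gt0.
by rewrite add0r; exact: res_mean0.
Qed.

End expected_potential.

Theorem theorem4p1 (R : realType) (H : completeNormedModType R)
  (dot : {dot H for idfun}) (Hdot : hilbert_norm dot)
  (L D sigma LDelta : R)
  (L_gt0 : 0 < L) (D_gt0 : 0 < D) (sigma_ge0 : 0 <= sigma)
  (LDelta_ge0 : 0 <= LDelta)
  (F : H -> H) (F_mono : monotone_fun dot F) (F_lip : L.-lipschitz F)
  (A : H -> set H) (A_max : maximally_monotone dot A)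
  (z0 zstar : H) (zstar_sol : [set F zstar + u | u in A zstar] 0)
  (z0_dist : `|z0 - zstar| <= D)
  (dS : measure_display) (S : measurableType dS) (mu : probability S R)
  (delta : S -> H -> H)
  (delta_meas : measurable_fun setT
     ((fun p => delta p.1 p.2) : S * borel H -> borel H))
  (delta_mean : forall z, is_bochner_integral mu (delta ^~ z) 0)
  (delta_var : forall z,
     (\int[mu]_s (`|delta s z| ^+ 2)%:E <= (sigma ^+ 2)%:E)%E)
  (delta_lip : forall x y,
     (\int[mu]_s (`|delta s x - delta s y| ^+ 2)%:E
        <= (LDelta ^+ 2 * `|x - y| ^+ 2)%:E)%E)
  (dO : measure_display) (Omega : measurableType dO) (P : probability Omega R)
  (xi : nat -> {mfun Omega >-> S})
  (xi_law : forall i B, measurable B -> distribution P (xi i) B = mu B)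
  (xi_indep : mutually_independent P xi)
  (z v : nat -> Omega -> H) :
  let Lbar := Num.sqrt (L ^+ 2 + LDelta ^+ 2) in
  is_vraf Lbar F A z0 delta (fun i => xi i) z v ->
  forall N : nat, (1 <= N)%N ->
  (\int[P]_w (residual F A (z N w) ^+ 2)
     <= (35 * ((Lbar ^+ 2 * D ^+ 2 + sigma ^+ 2) / (N%:R + 2)))%:E)%E.
Proof.
move=> Lbar zv N N1.
have L2 : 0 < L ^+ 2 + LDelta ^+ 2 by rewrite ltr_pwDl ?exprn_gt0 ?sqr_ge0.
have Lbar_gt0 : 0 < Lbar by rewrite sqrtr_gt0.
have LbarE : Lbar ^+ 2 = L ^+ 2 + LDelta ^+ 2 by rewrite sqr_sqrtr // ltW.
have A_mono := A_max.1.
(* For each point [x], [r x] lists the approximant values of the noise at [x]. Closing the hull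
   under [r] provides the noise support at the points [c m], from which [delta_support] reaches all
   of the hull. *)
have /choice[r rP] x := bochner_support (delta_mean x).
(* The constant relation [rel 0] puts [zstar] into the hull. *)
pose rel k x y := if k is j.+1 then resolvent (alpha Lbar j) A x y else y = zstar.
have resolvent_lip j x x' y y' : resolvent (alpha Lbar j) A x y ->
    resolvent (alpha Lbar j) A x' y' -> `|y - y'| <= `|x - x'|.
  exact: (resolvent_nonexpansive Hdot A_mono (ltW (alpha_gt0 Lbar_gt0 j))).
have rel_lip k x x' y y' : rel k x y -> rel k x' y' -> `|y - y'| <= `|x - x'|.
  case: k => [-> ->|j]; first by rewrite subrr normr0.
  exact: resolvent_lip.
have [c [Kz0 KD KZ KF [Krel cr]]] := separable_hull r z0 F_lip rel_lip.
have Kzstar : closure_seq c zstar by exact: (Krel 0%N z0).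
have resolventK j x y : closure_seq c x -> resolvent (alpha Lbar j) A x y ->
    closure_seq c y by exact: (Krel j.+1).
have delta_K x : closure_seq c x -> mu (delta ^~ x @^-1` (~` closure_seq c)) = 0%E.
  by apply: (delta_support delta_meas delta_lip) => m; apply: rP => i; exact: cr.
have [E [mE PE mz mv Kdelta]] := adapted xi_law xi_indep delta_meas KD KZ delta_K
  F_lip KF Kz0 resolvent_lip resolventK zv.
case: N N1 => // k _.
exact: (residual_bound Hdot xi_law xi_indep delta_meas delta_mean delta_var delta_lip
  KD KZ delta_K (ltW L_gt0) Lbar_gt0 LbarE F_mono F_lip A_mono zstar_sol KF Kz0
  Kzstar zv mE mz mv Kdelta z0_dist PE k).
Qed.
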